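(* For every integer $n\ge 1$ and every $c\in\mathbb{Q}$, one has $\partial_n^{(c)}(\mathfrak{H}^0)\subset\mathfrak{H}^0$ and $\partial_n^{(c)}(\mathfrak{H}^0)\subset\ker Z$; that is, $Z(\partial_n^{(c)}(w))=0$ for all $w\in\mathfrak{H}^0$.
   Context: Let $\mathfrak{H}=\mathbb{Q}\langle x,y\rangle$ be the noncommutative polynomial algebra over $\mathbb{Q}$ in two indeterminates $x,y$, and $z=x+y$. Let $\mathfrak{H}^1=\mathbb{Q}+\mathfrak{H}y$ and $\mathfrak{H}^0=\mathbb{Q}+x\mathfrak{H}y$. Let $Z:\mathfrak{H}^0\to\mathbb{R}$ be the $\mathbb{Q}$-linear map with $Z(1)=0$ and $Z(x^{k_1-1}yx^{k_2-1}y\cdots x^{k_n-1}y)=\zeta(k_1,\ldots,k_n)=\sum_{m_1>\cdots>m_n>0}m_1^{-k_1}\cdots m_n^{-k_n}$ (for $k_1\ge2$, $k_i\ge1$). Products of operators denote composition, $[A,B]=AB-BA$, $\mathrm{ad}(A)(B)=[A,B]$. $H:\mathfrak{H}\to\mathfrak{H}$ is the $\mathbb{Q}$-linear map with $H(w)=\deg(w)\,w$ for every word $w$. $\partial_1$ is the derivation of $\mathfrak{H}$ with $\partial_1(x)=xy$, $\partial_1(y)=-xy$. For $c\in\mathbb{Q}$, $\theta^{(c)}$ is the unique $\mathbb{Q}$-linear map $\mathfrak{H}\to\mathfrak{H}$ with $\theta^{(c)}(x)=\frac12(xz+zx)$, $\theta^{(c)}(y)=\frac12(yz+zy)$ and $\theta^{(c)}(ww')=\theta^{(c)}(w)w'+w\,\theta^{(c)}(w')+c\,\partial_1(w)H(w')$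 for all $w,w'\in\mathfrak{H}$. For $n\ge1$, $\partial_n^{(c)}=\frac{1}{(n-1)!}\mathrm{ad}(\theta^{(c)})^{n-1}(\partial_1)$. *)

(* Defs.v *)
From Stdlib Require Import Reals QArith Qreals List ClassicalEpsilon Arith.
Import ListNotations.

Inductive letter := lx | ly.
Definition letter_eq_dec : forall a b : letter, {a = b} + {a <> b}.
Proof. decide equality. Defined.
Definition word := list letter.
Definition word_eq_dec : forall u v : word, {u = v} + {u <> v} :=
  list_eq_dec letter_eq_dec.

(* An element of H = Q<x,y> is represented by a formal (unnormalised)
   Q-linear combination of words; its true coefficients are given by [coeff]. *)
Definition hpoly := list (Q * word).

Definition padd (p q : hpoly) : hpoly := p ++ q.
Definition pscale (a : Q) (p : hpoly) : hpoly :=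
  map (fun cw => ((a * fst cw)%Q, snd cw)) p.
Definition psub (p q : hpoly) : hpoly := padd p (pscale (-1)%Q q).
Definition pmul (p q : hpoly) : hpoly :=
  flat_map (fun cw => map (fun dv => ((fst cw * fst dv)%Q, snd cw ++ snd dv)) q) p.
Definition pword (w : word) : hpoly := [(1%Q, w)].
Definition lin (f : word -> hpoly) (p : hpoly) : hpoly :=
  flat_map (fun cw => pscale (fst cw) (f (snd cw))) p.
Definition coeff (p : hpoly) (u : word) : Q :=
  fold_right (fun cw acc => if word_eq_dec (snd cw) u then (fst cw + acc)%Q else acc)
    0%Q p.

Definition H_word (w : word) : hpoly := [(inject_Z (Z.of_nat (length w)), w)].
Definition Hop : hpoly -> hpoly := lin H_word.

Definition d1_letter (a : letter) : hpoly :=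
  match a with
  | lx => [(1%Q, [lx; ly])]
  | ly => [((-1)%Q, [lx; ly])]
  end.
Fixpoint d1_word (w : word) : hpoly :=
  match w with
  | [] => []
  | a :: w' => padd (pmul (d1_letter a) (pword w')) (pmul (pword [a]) (d1_word w'))
  end.
Definition d1 : hpoly -> hpoly := lin d1_word.

(* theta^(c) on letters: theta(x) = (xz+zx)/2 = xx + xy/2 + yx/2,
   theta(y) = (yz+zy)/2 = yy + yx/2 + xy/2 *)
Definition theta_letter (a : letter) : hpoly :=
  match a with
  | lx => [(1%Q, [lx; lx]); ((1#2)%Q, [lx; ly]); ((1#2)%Q, [ly; lx])]
  | ly => [(1%Q, [ly; ly]); ((1#2)%Q, [ly; lx]); ((1#2)%Q, [lx; ly])]
  end.
(* The unique map with theta(ww') = theta(w)w' + w theta(w') + c d1(w) H(w'),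
   computed recursively via w = a :: w' (forces theta(1) = 0). *)
Fixpoint theta_word (c : Q) (w : word) : hpoly :=
  match w with
  | [] => []
  | a :: w' =>
      padd (padd (pmul (theta_letter a) (pword w')) (pmul (pword [a]) (theta_word c w')))
           (pscale c (pmul (d1_letter a) (H_word w')))
  end.
Definition theta (c : Q) : hpoly -> hpoly := lin (theta_word c).

Definition comm (A B : hpoly -> hpoly) (p : hpoly) : hpoly := psub (A (B p)) (B (A p)).
Definition partial (n : nat) (c : Q) (p : hpoly) : hpoly :=
  pscale (/ inject_Z (Z.of_nat (fact (n - 1))))%Q
    (Nat.iter (n - 1) (fun D => comm (theta c) D) d1 p).

Definition is_adm (w : word) : bool :=
  match w with
  | lx :: _ => match last w lx with ly => true | lx => false end
  | _ => false
  end.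
(* membership in H^0 = Q + xHy : every word that is neither 1 nor in xHy
   has coefficient 0 *)
Definition inH0 (p : hpoly) : Prop :=
  forall u : word, u <> [] -> is_adm u = false -> (coeff p u == 0)%Q.

(* x^{k1-1} y ... x^{kn-1} y  |->  (k1,...,kn) *)
Fixpoint idx (k : nat) (w : word) : list nat :=
  match w with
  | [] => []
  | lx :: w' => idx (S k) w'
  | ly :: w' => S k :: idx 0 w'
  end.

Fixpoint sumR (f : nat -> R) (M : nat) : R :=
  match M with
  | O => 0%R
  | S M' => (sumR f M' + f M')%R
  end.
Fixpoint zS (ks : list nat) (M : nat) : R :=
  match ks with
  | [] => 1%R
  | k :: ks' => sumR (fun m => match m with
                               | O => 0%R
                               | _ => (/ (INR m ^ k) * zS ks' m)%R
                               end) M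
  end.
Definition mzv (ks : list nat) : R :=
  epsilon (inhabits 0%R) (fun l => Un_cv (fun N => zS ks (S N)) l).

Definition Z_word (w : word) : R := if is_adm w then mzv (idx 0 w) else 0%R.
(* Z extended Q-linearly; Z(1) = 0 *)
Definition Zmap (p : hpoly) : R :=
  fold_right (fun cw acc => (Q2R (fst cw) * Z_word (snd cw) + acc)%R) 0%R p.

(* Main.v *)
From Stdlib Require Import Reals QArith Qreals List Lra Lia FunctionalExtensionality
  ClassicalEpsilon.
From Coquelicot Require Import Coquelicot.
Require Import Defs.
Import ListNotations.
Local Open Scope R_scope.

(** Everything is transposed: an operator on H acts on functionals [word -> R],
    and a polynomial is only seen through its pairings with functionals.

    Algebra.  Left multiplication by z = x + y commutes with all the operators
    d_n^(c), so theta^(c) may be replaced by theta^(c) - z/2, which preserves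
    xH.  Strip the leading x and conjugate by the involution phi : x -> x + y,
    y -> -y.  Then d_1 becomes minus the harmonic product by y, and, on H^1,
    theta^(c) becomes (up to right multiplication by x/2) a derivation of the
    harmonic algebra: on quasi-symmetric functions in t_1, t_2, ... it is
    sum_j t_j^2 d/dt_j - c sum_(j < m) t_m t_j d/dt_j.  Hence d_n^(c) becomes
    harmonic multiplication by an element of Hy, so it preserves xHy, and the
    theorem reduces to the linear part of Kawashima's relation,
    Z(x phi(u * v)) = 0 for u, v in Hy.

    Analysis.  The multiple harmonic sum S_w(n) has the Newton expansion
    sum_m (-1)^(m-1) a_w(m) binom(n, m), where the a_w(m) are multiple harmonic
    sums for phi(w).  The derivative at n of the interpolating function is
    E_w(n) = sum_m D_w(n, m) / m, with D_w(n, m) = (-1)^(m-1) Delta^m S_w(n), and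
    E_w(0) = - Z(x phi(w)).  The pairs S_w + eps E_w satisfy the recursion of
    harmonic sums with 1/m replaced by 1/(m + eps), and E_w(n) tends to 0; so
    E_(u*v) = S_u E_v + E_u S_v, which vanishes at n = 0. *)

(** * Pairing of polynomials with functionals on words *)

Definition ev (f : word -> R) (p : hpoly) : R :=
  fold_right (fun cw acc => Q2R (fst cw) * f (snd cw) + acc) 0 p.

Lemma ev_cons f cw p : ev f (cw :: p) = Q2R (fst cw) * f (snd cw) + ev f p.
Proof. reflexivity. Qed.

Lemma ev_padd f p q : ev f (padd p q) = ev f p + ev f q.
Proof.
  unfold padd; induction p as [|cw p IH]; [simpl; ring|].
  cbn [app]; rewrite !ev_cons, IH; ring.
Qed.

Lemma ev_pscale f a p : ev f (pscale a p) = Q2R a * ev f p.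
Proof.
  unfold pscale; induction p as [|cw p IH]; [simpl; ring|].
  cbn [map]; rewrite !ev_cons, IH; cbn [fst snd]; rewrite Q2R_mult; ring.
Qed.

Lemma ev_lin f A p : ev f (lin A p) = ev (fun w => ev f (A w)) p.
Proof.
  induction p as [|cw p IH]; [reflexivity|].
  change (lin A (cw :: p)) with (padd (pscale (fst cw) (A (snd cw))) (lin A p)).
  now rewrite ev_padd, ev_pscale, IH.
Qed.

Lemma ev_pmul f p q : ev f (pmul p q) = ev (fun u => ev (fun v => f (u ++ v)) q) p.
Proof.
  induction p as [|cw p IH]; [reflexivity|].
  change (pmul (cw :: p) q) with
    (padd (map (fun dv : Q * word => ((fst cw * fst dv)%Q, (snd cw ++ snd dv) : word)) q) (pmul p q)).
  rewrite ev_padd, ev_cons, IH; f_equal; clear IH; cbv beta.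
  induction q as [|dv q IHq]; [simpl; ring|].
  cbn [map]; rewrite !ev_cons, IHq; cbn [fst snd]; rewrite Q2R_mult; ring.
Qed.

Lemma ev_psub f p q : ev f (psub p q) = ev f p - ev f q.
Proof.
  unfold psub; rewrite ev_padd, ev_pscale.
  replace (Q2R (-1)) with (-1) by (unfold Q2R; simpl; lra); ring.
Qed.

Definition wdelta (u w : word) : R := if word_eq_dec w u then 1 else 0.

Lemma coeff_ev p u : Q2R (coeff p u) = ev (wdelta u) p.
Proof.
  induction p as [|cw p IH]; [unfold Q2R; simpl; lra|].
  rewrite ev_cons, <- IH; unfold wdelta; simpl.
  destruct word_eq_dec; [rewrite Q2R_plus|]; ring.
Qed.

Lemma ev_ext_in f g p : (forall cw, In cw p -> f (snd cw) = g (snd cw)) -> ev f p = ev g p.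
Proof.
  induction p as [|cw p IH]; intros H; [reflexivity|].
  rewrite !ev_cons, IH, H; auto using in_eq, in_cons.
Qed.

Lemma ev_linear a f g p : ev (fun w => a * f w + g w) p = a * ev f p + ev g p.
Proof.
  induction p as [|cw p IH]; [simpl; ring|].
  rewrite !ev_cons, IH; ring.
Qed.

(* Subtracting [f u * wdelta u] from [f] for a word [u] of [p] shrinks the set
   of words of [p] on which [f] does not vanish. *)
Lemma ev_eq0 p : forall f, (forall u, f u = 0 \/ ev (wdelta u) p = 0) -> ev f p = 0.
Proof.
  assert (main : forall l f, (forall cw, In cw p -> In (snd cw) l \/ f (snd cw) = 0) ->
    (forall u, f u = 0 \/ ev (wdelta u) p = 0) -> ev f p = 0).
  { induction l as [|u l IH]; intros f Hl Hf.
    - rewrite (ev_ext_in f (fun _ => 0)).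
      + clear; induction p as [|cw p IH]; [reflexivity|rewrite ev_cons, IH; ring].
      + intros cw Hcw; destruct (Hl cw Hcw) as [[]|]; assumption.
    - rewrite (ev_ext_in f (fun w => f u * wdelta u w + (if word_eq_dec w u then 0 else f w))).
      + rewrite (ev_linear (f u) (wdelta u)), (IH (fun w => if word_eq_dec w u then 0 else f w)).
        * destruct (Hf u) as [-> | ->]; ring.
        * intros cw Hcw; destruct word_eq_dec as [|ne]; [now right|].
          destruct (Hl cw Hcw) as [[e|]|]; auto; congruence.
        * intros v; destruct word_eq_dec; auto.
      + intros cw _; unfold wdelta; destruct word_eq_dec as [->|]; ring. }
  intros f Hf; apply (main (map snd p)); [|exact Hf].
  intros cw Hcw; left; now apply in_map.
Qed.

(** * Transposes of the operators, and left multiplication by z *)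

Definition ld (a : letter) (f : word -> R) : word -> R := fun w => f (a :: w).
Definition len (w : word) : R := INR (length w).

Fixpoint d1_tr (f : word -> R) (w : word) : R :=
  match w with
  | [] => 0
  | lx :: w' => f (lx :: ly :: w') + d1_tr (ld lx f) w'
  | ly :: w' => - f (lx :: ly :: w') + d1_tr (ld ly f) w'
  end.

Fixpoint theta_tr (c : R) (f : word -> R) (w : word) : R :=
  match w with
  | [] => 0
  | lx :: w' => f (lx :: lx :: w') + (f (lx :: ly :: w') + f (ly :: lx :: w')) / 2
      + theta_tr c (ld lx f) w' + c * len w' * f (lx :: ly :: w')
  | ly :: w' => f (ly :: ly :: w') + (f (ly :: lx :: w') + f (lx :: ly :: w')) / 2
      + theta_tr c (ld ly f) w' - c * len w' * f (lx :: ly :: w')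
  end.

Lemma ev_d1_word w : forall f, ev f (d1_word w) = d1_tr f w.
Proof.
  induction w as [|a w IH]; intros f; [reflexivity|].
  cbn [d1_word]; rewrite ev_padd, !ev_pmul.
  destruct a; simpl; rewrite <- IH; unfold ld; unfold Q2R; simpl; field.
Qed.

Lemma ev_theta_word c w : forall f, ev f (theta_word c w) = theta_tr (Q2R c) f w.
Proof.
  induction w as [|a w IH]; intros f; [reflexivity|].
  cbn [theta_word]; rewrite !ev_padd, ev_pscale, !ev_pmul.
  assert (El : Q2R (inject_Z (Z.of_nat (length w))) = len w).
  { unfold Q2R, inject_Z, len; simpl; rewrite INR_IZR_INZ; field. }
  destruct a; simpl; rewrite El, <- IH; unfold ld;
    replace (Q2R 1) with 1 by (unfold Q2R; simpl; lra);
    replace (Q2R (1 # 2)) with (/ 2) by (unfold Q2R; simpl; lra);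
    try replace (Q2R (-1)) with (-1) by (unfold Q2R; simpl; lra); field.
Qed.

(** Transposition reverses composition, hence the order of the two terms of the commutator. Index n
    belongs to n! times d_(n+1)^(c). *)
Fixpoint partial_tr (c : R) (n : nat) (f : word -> R) : word -> R :=
  match n with
  | O => d1_tr f
  | S n' => fun w => partial_tr c n' (theta_tr c f) w - theta_tr c (partial_tr c n' f) w
  end.

Lemma ev_iter_comm c n : forall f p,
  ev f (Nat.iter n (fun D => comm (theta c) D) d1 p) = ev (partial_tr (Q2R c) n f) p.
Proof.
  induction n as [|n IH]; intros f p.
  - simpl; unfold d1; rewrite ev_lin; f_equal.
    apply functional_extensionality; intros w; apply ev_d1_word.
  - assert (Eth : forall g q, ev g (theta c q) = ev (theta_tr (Q2R c) g) q).
    { intros g q; unfold theta; rewrite ev_lin; f_equal.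
      apply functional_extensionality; intros w; apply ev_theta_word. }
    simpl; unfold comm at 1; rewrite ev_psub, Eth, !IH, Eth.
    set (F := partial_tr _ _ (theta_tr _ _)); set (G := theta_tr _ _).
    replace (fun w => F w - G w) with (fun w => (-1) * G w + F w)
      by (apply functional_extensionality; intros; ring).
    rewrite ev_linear; ring.
Qed.

(** With [B := unit] this also covers scalar-valued functionals such as [mult_elt]. *)
Definition linear {A B : Type} (T : (A -> R) -> B -> R) : Prop :=
  forall k f g b, T (fun a => k * f a + g a) b = k * T f b + T g b.

Section LinearLemmas.
Context {A B : Type} (T : (A -> R) -> B -> R) (HT : linear T).

Lemma linear_plus f g b : T (fun a => f a + g a) b = T f b + T g b.
Proof.
  replace (fun a => f a + g a) with (fun a => 1 * f a + g a)
    by (apply functional_extensionality; intros; ring).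
  rewrite HT; ring.
Qed.

Lemma linear_minus f g b : T (fun a => f a - g a) b = T f b - T g b.
Proof.
  replace (fun a => f a - g a) with (fun a => (-1) * g a + f a)
    by (apply functional_extensionality; intros; ring).
  rewrite HT; ring.
Qed.

Lemma linear_zero b : T (fun _ => 0) b = 0.
Proof.
  replace (fun _ => 0) with (fun _ : A => 0 - 0)
    by (apply functional_extensionality; intros; ring).
  rewrite linear_minus; ring.
Qed.

Lemma linear_scal k f b : T (fun a => k * f a) b = k * T f b.
Proof.
  replace (fun a => k * f a) with (fun a => k * f a + 0)
    by (apply functional_extensionality; intros; ring).
  rewrite HT, linear_zero; ring.
Qed.

Lemma linear_opp f b : T (fun a => - f a) b = - T f b.
Proof.
  replace (fun a => - f a) with (fun a => (-1) * f a)
    by (apply functional_extensionality; intros; ring).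
  rewrite linear_scal; ring.
Qed.
End LinearLemmas.

Lemma linear_comp {A B C} (T : (A -> R) -> B -> R) (U : (B -> R) -> C -> R) :
  linear T -> linear U -> linear (fun f => U (T f)).
Proof.
  intros HT HU k f g b.
  replace (T (fun a => k * f a + g a)) with (fun b => k * T f b + T g b)
    by (apply functional_extensionality; intros; symmetry; apply HT).
  apply HU.
Qed.

Lemma linear_sub {A B} (T U : (A -> R) -> B -> R) :
  linear T -> linear U -> linear (fun f b => T f b - U f b).
Proof. intros HT HU k f g b; rewrite HT, HU; ring. Qed.

Lemma d1_tr_linear : linear d1_tr.
Proof.
  intros k f g w; revert f g.
  induction w as [|[] w IH]; intros f g; simpl; [ring| |]; unfold ld in *; rewrite IH; ring.
Qed.

Lemma theta_tr_linear c : linear (theta_tr c).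
Proof.
  intros k f g w; revert f g.
  induction w as [|[] w IH]; intros f g; simpl; [ring| |]; unfold ld in *; rewrite IH; field.
Qed.

Lemma partial_tr_linear c n : linear (partial_tr c n).
Proof.
  induction n as [|n IH]; [exact d1_tr_linear|].
  apply linear_sub; apply linear_comp; auto using theta_tr_linear.
Qed.

Lemma partial_tr_nil c n f : partial_tr c n f [] = 0.
Proof.
  revert f; induction n as [|n IH]; intros f; simpl; [reflexivity|].
  rewrite IH; ring.
Qed.

Definition ldz (f : word -> R) : word -> R := fun w => f (lx :: w) + f (ly :: w).

(** Since d_1(z) = 0, the c-term drops out of theta(z w), which leaves z theta(w) + z^2 w. *)
Lemma theta_tr_ldz c f : ldz (theta_tr c f) = fun w => theta_tr c (ldz f) w + ldz (ldz f) w.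
Proof.
  apply functional_extensionality; intros w.
  unfold ldz at 1; simpl; unfold ldz at 1.
  change (fun w => f (lx :: w) + f (ly :: w)) with (fun w => ld lx f w + ld ly f w).
  rewrite (linear_plus _ (theta_tr_linear c)).
  unfold ldz; field.
Qed.

(** The term z^2 w of [theta_tr_ldz] enters both halves of the commutator and cancels, because the
    operator of index n commutes with z by induction. *)
Lemma partial_tr_ldz c n : forall f, ldz (partial_tr c n f) = partial_tr c n (ldz f).
Proof.
  induction n as [|n IH]; intros f; apply functional_extensionality; intros w.
  - unfold ldz at 1; simpl; unfold ldz at 1.
    change (fun w => f (lx :: w) + f (ly :: w)) with (fun w => ld lx f w + ld ly f w).
    rewrite (linear_plus _ d1_tr_linear); ring.
  - replace (ldz (partial_tr c (S n) f) w)
      with (ldz (partial_tr c n (theta_tr c f)) w - ldz (theta_tr c (partial_tr c n f)) w)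
      by (unfold ldz; simpl; ring).
    rewrite IH, !theta_tr_ldz, (linear_plus _ (partial_tr_linear c n)), !IH; simpl; ring.
Qed.

(** * Conjugation by the involution x |-> x + y, y |-> -y *)

Fixpoint phi_tr (f : word -> R) (w : word) : R :=
  match w with
  | [] => f []
  | lx :: w' => phi_tr (ld lx f) w' + phi_tr (ld ly f) w'
  | ly :: w' => - phi_tr (ld ly f) w'
  end.

Lemma phi_tr_linear : linear phi_tr.
Proof.
  intros k f g w; revert f g.
  induction w as [|[] w IH]; intros f g; simpl; [ring| |]; unfold ld in *; rewrite !IH; ring.
Qed.

Lemma ld_phi_tr_x f : ld lx (phi_tr f) = fun w => phi_tr (ld lx f) w + phi_tr (ld ly f) w.
Proof. reflexivity. Qed.

Lemma ld_phi_tr_y f : ld ly (phi_tr f) = fun w => - phi_tr (ld ly f) w.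
Proof. reflexivity. Qed.

Lemma phi_tr_involutive f : phi_tr (phi_tr f) = f.
Proof.
  apply functional_extensionality; intros w; revert f.
  induction w as [|[] w IH]; intros f; [reflexivity| |]; cbn [phi_tr];
    rewrite ?ld_phi_tr_x, ld_phi_tr_y, ?(linear_plus _ phi_tr_linear), (linear_opp _ phi_tr_linear), !IH;
    unfold ld; ring.
Qed.

(** Transpose of phi d_1 phi, the derivation x -> 0, y -> -(x + y) y. *)
Fixpoint d1_conj (f : word -> R) (w : word) : R :=
  match w with
  | [] => 0
  | lx :: w' => d1_conj (ld lx f) w'
  | ly :: w' => - f (lx :: ly :: w') - f (ly :: ly :: w') + d1_conj (ld ly f) w'
  end.

(** Transpose of phi theta phi: x -> x^2, y -> (x y + y x) / 2, with the twisted Leibniz rule in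
    which d_1 is replaced by its conjugate. *)
Fixpoint theta_conj (c : R) (f : word -> R) (w : word) : R :=
  match w with
  | [] => 0
  | lx :: w' => f (lx :: lx :: w') + theta_conj c (ld lx f) w'
  | ly :: w' => (f (ly :: lx :: w') + f (lx :: ly :: w')) / 2 + theta_conj c (ld ly f) w'
      - c * len w' * (f (lx :: ly :: w') + f (ly :: ly :: w'))
  end.

Lemma d1_conj_linear : linear d1_conj.
Proof.
  intros k f g w; revert f g.
  induction w as [|[] w IH]; intros f g; simpl; [ring| |]; unfold ld in *; rewrite IH; ring.
Qed.

Lemma theta_conj_linear c : linear (theta_conj c).
Proof.
  intros k f g w; revert f g.
  induction w as [|[] w IH]; intros f g; simpl; [ring| |]; unfold ld in *; rewrite IH; field.
Qed.

Lemma phi_tr_len f w : phi_tr (fun v => len v * f v) w = len w * phi_tr f w.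
Proof.
  (* The offset [k] absorbs the letter stripped off at each induction step. *)
  assert (main : forall w k f,
    phi_tr (fun v => (k + len v) * f v) w = (k + len w) * phi_tr f w).
  { clear; induction w as [|a w IH]; intros k f; [reflexivity|].
    assert (Es : forall b, ld b (fun v => (k + len v) * f v)
                 = fun v => ((k + 1) + len v) * ld b f v).
    { intros b; apply functional_extensionality; intros v; unfold ld, len.
      cbn [length]; rewrite S_INR; ring. }
    assert (El : len (a :: w) = len w + 1) by (unfold len; cbn [length]; apply S_INR).
    rewrite El; destruct a; cbn [phi_tr]; rewrite !Es, !IH; ring. }
  specialize (main w 0 f); rewrite Rplus_0_l in main; rewrite <- main; f_equal.
  apply functional_extensionality; intros; ring.
Qed.

Lemma d1_tr_phi_tr f : d1_tr (phi_tr f) = phi_tr (d1_conj f).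
Proof.
  apply functional_extensionality; intros w; revert f.
  induction w as [|[] w IH]; intros f; [reflexivity| |].
  - cbn [d1_tr phi_tr]; rewrite ld_phi_tr_x, (linear_plus _ d1_tr_linear), !IH.
    change (ld lx (d1_conj f)) with (d1_conj (ld lx f)).
    change (ld ly (d1_conj f)) with
      (fun w => - f (lx :: ly :: w) - f (ly :: ly :: w) + d1_conj (ld ly f) w).
    rewrite (linear_plus _ phi_tr_linear), (linear_minus _ phi_tr_linear), (linear_opp _ phi_tr_linear).
    unfold ld; ring.
  - cbn [d1_tr phi_tr]; rewrite ld_phi_tr_y, (linear_opp _ d1_tr_linear), !IH.
    change (ld ly (d1_conj f)) with
      (fun w => - f (lx :: ly :: w) - f (ly :: ly :: w) + d1_conj (ld ly f) w).
    rewrite (linear_plus _ phi_tr_linear), (linear_minus _ phi_tr_linear), (linear_opp _ phi_tr_linear).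
    unfold ld; ring.
Qed.

Lemma theta_tr_phi_tr c f : theta_tr c (phi_tr f) = phi_tr (theta_conj c f).
Proof.
  assert (Ey : forall f, ld ly (theta_conj c f) = fun w =>
     /2 * (f (ly :: lx :: w) + f (lx :: ly :: w)) + theta_conj c (ld ly f) w
       - c * (len w * (f (lx :: ly :: w) + f (ly :: ly :: w)))).
  { intros g; apply functional_extensionality; intros w; unfold ld; simpl; unfold ld; field. }
  assert (Ey' : forall f w, phi_tr (ld ly (theta_conj c f)) w =
     /2 * (phi_tr (fun v => f (ly :: lx :: v)) w + phi_tr (fun v => f (lx :: ly :: v)) w)
     + phi_tr (theta_conj c (ld ly f)) w
     - c * (len w * (phi_tr (fun v => f (lx :: ly :: v)) w + phi_tr (fun v => f (ly :: ly :: v)) w))).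
  { intros g w; rewrite Ey, (linear_minus _ phi_tr_linear), (linear_plus _ phi_tr_linear).
    rewrite !(linear_scal _ phi_tr_linear), phi_tr_len, !(linear_plus _ phi_tr_linear); ring. }
  apply functional_extensionality; intros w; revert f.
  induction w as [|[] w IH]; intros f; [reflexivity| |].
  - cbn [theta_tr phi_tr]; rewrite ld_phi_tr_x, (linear_plus _ (theta_tr_linear c)), !IH, Ey'.
    change (ld lx (theta_conj c f)) with (fun w => f (lx :: lx :: w) + theta_conj c (ld lx f) w).
    rewrite (linear_plus _ phi_tr_linear).
    unfold ld; field.
  - cbn [theta_tr phi_tr]; rewrite ld_phi_tr_y, (linear_opp _ (theta_tr_linear c)), !IH, Ey'.
    unfold ld; field.
Qed.

(** One has theta(x w) - z x w / 2 = x (theta(w) + z w / 2 + c y H(w)). Conjugating the bracketed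
    operator by phi, with phi(z) = x and phi(y) = -y, gives the transpose of this one. *)
Definition theta_shift (c : R) (f : word -> R) (w : word) : R :=
  theta_conj c f w + f (lx :: w) / 2 - c * (len w * f (ly :: w)).

(** Index 0 comes from d_1(x w) = x (y w + d_1(w)), stripped of x and conjugated. *)
Fixpoint partial_conj (c : R) (n : nat) (f : word -> R) : word -> R :=
  match n with
  | O => fun w => d1_conj f w - f (ly :: w)
  | S n' => fun w => partial_conj c n' (theta_shift c f) w - theta_shift c (partial_conj c n' f) w
  end.

Lemma theta_shift_linear c : linear (theta_shift c).
Proof. intros k f g w; unfold theta_shift; rewrite theta_conj_linear; field. Qed.

Lemma partial_conj_linear c n : linear (partial_conj c n).
Proof.
  induction n as [|n IH].
  - intros k f g w; simpl; rewrite d1_conj_linear; ring.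
  - apply linear_sub; apply linear_comp; auto using theta_shift_linear.
Qed.

Lemma phi_tr_theta_shift c f : phi_tr (theta_shift c f) = fun w =>
  theta_tr c (phi_tr f) w + ldz (phi_tr f) w / 2 + c * (len w * ld ly (phi_tr f) w).
Proof.
  apply functional_extensionality; intros w.
  rewrite theta_tr_phi_tr.
  replace (theta_shift c f) with (fun w => theta_conj c f w + /2 * ld lx f w - c * (len w * ld ly f w))
    by (apply functional_extensionality; intros v; unfold theta_shift, ld; field).
  rewrite (linear_minus _ phi_tr_linear), (linear_plus _ phi_tr_linear).
  rewrite !(linear_scal _ phi_tr_linear), phi_tr_len.
  unfold ldz, ld; cbn [phi_tr]; unfold ld; field.
Qed.

Lemma theta_tr_ld_x c f : ld lx (theta_tr c f) = fun w =>
  phi_tr (theta_shift c (phi_tr (ld lx f))) w + /2 * ld lx (ldz f) w.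
Proof.
  apply functional_extensionality; intros w; rewrite phi_tr_theta_shift, phi_tr_involutive.
  unfold ldz, ld; cbn [theta_tr]; unfold ld; field.
Qed.

(** Replacing theta by theta - z/2 does not change the commutators, because left multiplication by z
    commutes with all of them ([partial_tr_ldz]). *)
Lemma partial_tr_ld_x c n : forall f, ld lx (partial_tr c n f) = phi_tr (partial_conj c n (phi_tr (ld lx f))).
Proof.
  induction n as [|n IH]; intros f.
  - cbn [partial_conj partial_tr].
    change (fun w => d1_conj (phi_tr (ld lx f)) w - phi_tr (ld lx f) (ly :: w))
      with (fun w => d1_conj (phi_tr (ld lx f)) w - ld ly (phi_tr (ld lx f)) w).
    apply functional_extensionality; intros w.
    rewrite (linear_minus _ phi_tr_linear), <- d1_tr_phi_tr, phi_tr_involutive, ld_phi_tr_y.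
    rewrite (linear_opp _ phi_tr_linear), phi_tr_involutive; unfold ld; cbn [d1_tr]; unfold ld; ring.
  - apply functional_extensionality; intros w.
    change (ld lx (partial_tr c (S n) f) w)
      with (ld lx (partial_tr c n (theta_tr c f)) w - ld lx (theta_tr c (partial_tr c n f)) w).
    cbn [partial_conj].
    rewrite (linear_minus _ phi_tr_linear), IH.
    rewrite (theta_tr_ld_x c f).
    set (g := phi_tr (theta_shift c (phi_tr (ld lx f)))).
    replace (phi_tr (fun w => g w + /2 * ld lx (ldz f) w))
      with (fun w => phi_tr g w + /2 * phi_tr (ld lx (ldz f)) w)
      by (apply functional_extensionality; intros v;
          rewrite (linear_plus _ phi_tr_linear), (linear_scal _ phi_tr_linear); reflexivity).
    replace (partial_conj c n (fun w => phi_tr g w + /2 * phi_tr (ld lx (ldz f)) w))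
      with (fun w => partial_conj c n (phi_tr g) w + /2 * partial_conj c n (phi_tr (ld lx (ldz f))) w)
      by (apply functional_extensionality; intros v;
          rewrite (linear_plus _ (partial_conj_linear c n)), (linear_scal _ (partial_conj_linear c n)); reflexivity).
    rewrite (linear_plus _ phi_tr_linear), (linear_scal _ phi_tr_linear), <- (IH (ldz f)).
    rewrite <- partial_tr_ldz, theta_tr_ld_x, IH.
    unfold g; rewrite !phi_tr_involutive; ring.
Qed.

(** * The harmonic product *)

(* The exponent list [a1; ...; ar] stands for x^a1 y ... x^ar y, i.e. for the
   index (a1 + 1, ..., ar + 1); [enc] appends x^j. *)
Fixpoint enc (ks : list nat) (j : nat) : word :=
  match ks with
  | [] => repeat lx j
  | a :: ks' => repeat lx a ++ ly :: enc ks' j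
  end.

Fixpoint wt (ks : list nat) : nat :=
  match ks with
  | [] => 0
  | a :: ks' => S a + wt ks'
  end.

Definition pre (a : nat) (F : list nat -> R) : list nat -> R := fun ks => F (a :: ks).

(* [harm F us vs] is the pairing of [F] with the harmonic product us * vs. *)
Fixpoint harm (F : list nat -> R) (us : list nat) {struct us} : list nat -> R :=
  match us with
  | [] => F
  | a :: u =>
      (fix harm_r (F : list nat -> R) (vs : list nat) {struct vs} : R :=
         match vs with
         | [] => F (a :: u)
         | b :: v => harm (pre a F) u (b :: v) + harm_r (pre b F) v
                     + harm (pre (S (a + b)) F) u v
         end) F
  end.

(** The leading indices a + 1 and b + 1 merge into a + b + 2, whose exponent is [S (a + b)]. *)
Lemma harm_cons F a u b v : harm F (a :: u) (b :: v) =
  harm (pre a F) u (b :: v) + harm (pre b F) (a :: u) v + harm (pre (S (a + b)) F) u v.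
Proof. reflexivity. Qed.

Lemma harm_nil_r F us : harm F us [] = F us.
Proof. destruct us; reflexivity. Qed.

(** Induction along the recursive calls of [harm]: one hypothesis for each summand of
    [harm_cons]. *)
Definition list_pair_ind (P : list nat -> list nat -> Prop)
  (H1 : forall vs, P [] vs) (H2 : forall a u, P (a :: u) [])
  (H3 : forall a u b v, P u (b :: v) -> P (a :: u) v -> P u v -> P (a :: u) (b :: v)) :
  forall us vs, P us vs.
Proof.
  induction us as [|a u IHu]; [exact H1|].
  induction vs as [|b v IHv]; auto.
Qed.

Lemma harm_linear_l us : linear (fun F : list nat -> R => harm F us).
Proof.
  intros k F G vs; revert F G; pattern us, vs; apply list_pair_ind; clear us vs.
  - reflexivity.
  - reflexivity.
  - intros a u b v IH1 IH2 IH3 F G; rewrite !harm_cons; unfold pre in *.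
    rewrite IH1, IH2, IH3; ring.
Qed.

Lemma harm_plus F G us vs : harm (fun ks => F ks + G ks) us vs = harm F us vs + harm G us vs.
Proof. exact (linear_plus _ (harm_linear_l us) F G vs). Qed.

Lemma harm_minus F G us vs : harm (fun ks => F ks - G ks) us vs = harm F us vs - harm G us vs.
Proof. exact (linear_minus _ (harm_linear_l us) F G vs). Qed.

Lemma harm_scal k F us vs : harm (fun ks => k * F ks) us vs = k * harm F us vs.
Proof. exact (linear_scal _ (harm_linear_l us) k F vs). Qed.

Definition harm_y (F : list nat -> R) : list nat -> R := harm F [0%nat].

Lemma harm_y_nil F : harm_y F [] = F [0%nat].
Proof. reflexivity. Qed.

Lemma harm_y_cons F b v : harm_y F (b :: v) = F (0%nat :: b :: v) + harm_y (pre b F) v + F (S b :: v).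
Proof. reflexivity. Qed.

Lemma pre_harm_y b F : pre b (harm_y F) = fun v => F (0%nat :: b :: v) + harm_y (pre b F) v + F (S b :: v).
Proof. reflexivity. Qed.

Lemma harm_y_linear : linear harm_y.
Proof. apply harm_linear_l. Qed.

Lemma harm_comm us vs : forall F, harm F us vs = harm F vs us.
Proof.
  pattern us, vs; apply list_pair_ind; clear us vs.
  - intros vs F; now rewrite harm_nil_r.
  - reflexivity.
  - intros a u b v IH1 IH2 IH3 F; rewrite !harm_cons, IH1, IH2, IH3, (Nat.add_comm a b); ring.
Qed.

Lemma pre_harm a u b F : pre b (harm F (a :: u)) = fun v =>
  harm (pre a F) u (b :: v) + harm (pre b F) (a :: u) v + harm (pre (S (a + b)) F) u v.
Proof. reflexivity. Qed.

(* y * (u * v) = u * (y * v) *)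
Lemma harm_harm_y us vs : forall F, harm (harm_y F) us vs = harm_y (harm F us) vs.
Proof.
  pattern us, vs; apply list_pair_ind; clear us vs.
  - reflexivity.
  - intros a u F; rewrite harm_nil_r, harm_y_nil, harm_cons, !harm_nil_r, harm_y_cons, Nat.add_0_r.
    rewrite (harm_comm u); unfold pre, harm_y; ring.
  - intros a u b v IH1 IH2 IH3 F.
    rewrite harm_y_cons, !pre_harm, !(linear_plus _ harm_y_linear).
    change (fun v0 => harm (pre a F) u (b :: v0)) with (pre b (harm (pre a F) u)).
    rewrite <- IH2, <- IH3.
    rewrite !harm_cons, !pre_harm_y, !harm_plus, IH1, harm_y_cons, Nat.add_0_r, Nat.add_succ_r.
    unfold pre; ring.
Qed.

(** All words of a harmonic product have the same weight. *)
Lemma harm_wt us vs : forall F,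
  harm (fun ks => INR (wt ks) * F ks) us vs = INR (wt us + wt vs) * harm F us vs.
Proof.
  assert (main : forall us vs k F,
    harm (fun ks => INR (k + wt ks) * F ks) us vs = INR (k + (wt us + wt vs)) * harm F us vs).
  { clear us vs; intros us vs; pattern us, vs; apply list_pair_ind; clear us vs.
    - reflexivity.
    - intros a u k F; rewrite !harm_nil_r; cbn [wt]; do 2 f_equal; lia.
    - intros a u b v IH1 IH2 IH3 k F.
      assert (E : forall d, pre d (fun ks => INR (k + wt ks) * F ks)
                  = fun ks => INR ((k + S d) + wt ks) * pre d F ks).
      { intros d; apply functional_extensionality; intros ks; unfold pre; cbn [wt].
        do 2 f_equal; lia. }
      rewrite !harm_cons, !E, IH1, IH2, IH3; cbn [wt].
      replace (k + S a + (wt u + (S b + wt v)))%nat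
        with (k + (S a + wt u + (S b + wt v)))%nat by lia.
      replace (k + S b + (S a + wt u + wt v))%nat
        with (k + (S a + wt u + (S b + wt v)))%nat by lia.
      replace (k + S (S (a + b)) + (wt u + wt v))%nat
        with (k + (S a + wt u + (S b + wt v)))%nat by lia.
      ring. }
  intros F; exact (main us vs 0%nat F).
Qed.

(** * A derivation of the harmonic algebra *)

(** The transpose of sum_j t_j^2 d/dt_j - c sum_(j < m) t_m t_j d/dt_j, the leading block carrying
    the largest variable. The first block grows by its own derivative or by absorbing t_m, or the
    change happens further right, or t_m forms a new block in front; [wt] adds up the exponents of
    the blocks right of t_m. *)
Fixpoint harm_der (c : R) (F : list nat -> R) (ks : list nat) : R :=
  match ks with
  | [] => 0
  | a :: ks' => (INR (S a) - c * INR (wt ks')) * F (S a :: ks') + harm_der c (pre a F) ks'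
                - c * INR (wt ks) * F (0%nat :: a :: ks')
  end.

Lemma harm_der_cons c F a ks : harm_der c F (a :: ks) =
  (INR (S a) - c * INR (wt ks)) * F (S a :: ks) + harm_der c (pre a F) ks
  - c * INR (S a + wt ks) * F (0%nat :: a :: ks).
Proof. reflexivity. Qed.

Lemma harm_der_linear c : linear (harm_der c).
Proof.
  intros k F G ks; revert F G.
  induction ks as [|a ks IH]; intros F G; [simpl; ring|].
  rewrite !harm_der_cons; unfold pre in *; rewrite IH; ring.
Qed.

(** The weights inside [harm_der] are constant on the words of a product, so [harm_wt] moves them
    outside. *)
Lemma harm_pre_harm_der c F a us vs : harm (pre a (harm_der c F)) us vs =
  INR (S a) * harm (pre (S a) F) us vs - c * (INR (wt us + wt vs) * harm (pre (S a) F) us vs)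
  + harm (harm_der c (pre a F)) us vs
  - c * (INR (S a) * harm (pre a (pre 0%nat F)) us vs
         + INR (wt us + wt vs) * harm (pre a (pre 0%nat F)) us vs).
Proof.
  rewrite <- !harm_wt, <- !harm_scal, <- !harm_plus, <- !harm_scal, <- !harm_minus, <- !harm_plus, <- !harm_minus.
  f_equal; apply functional_extensionality; intros ks; unfold pre at 1.
  rewrite harm_der_cons, plus_INR; unfold pre; ring.
Qed.

(** The Leibniz rule of a first-order differential operator, transposed. After splitting off the
    first blocks, the induction hypotheses settle what happens behind them, and the rest is a
    comparison of coefficients. *)
Lemma harm_harm_der c us vs : forall F,
  harm (harm_der c F) us vs = harm_der c (harm F us) vs + harm_der c (fun u => harm F u vs) us.
Proof.
  pattern us, vs; apply list_pair_ind; clear us vs.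
  - intros vs F; simpl; ring.
  - intros a u F; rewrite harm_nil_r.
    replace (fun u0 => harm F u0 []) with F
      by (apply functional_extensionality; intros; now rewrite harm_nil_r).
    simpl (harm_der c (harm _ _) []); ring.
  - intros a u b v IH1 IH2 IH3 F.
    rewrite harm_cons, !harm_pre_harm_der, IH1, IH2, IH3, !harm_der_cons.
    rewrite pre_harm.
    assert (E : pre a (fun u0 => harm F u0 (b :: v)) = fun u0 =>
      harm (pre a F) u0 (b :: v) + harm (pre b F) (a :: u0) v + harm (pre (S (a + b)) F) u0 v)
      by reflexivity.
    rewrite E, !(linear_plus _ (harm_der_linear c)).
    change (fun v0 => harm (pre a F) u (b :: v0)) with (pre b (harm (pre a F) u)).
    change (fun u0 => harm (pre b F) (a :: u0) v) with (pre a (fun u0 => harm (pre b F) u0 v)).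
    rewrite !harm_cons, !Nat.add_0_r, !Nat.add_0_l, !Nat.add_succ_r; cbn [wt Nat.add].
    repeat (rewrite S_INR || rewrite plus_INR).
    unfold pre; ring.
Qed.

(** * The conjugated operators as operators of the harmonic algebra *)

Definition fenc (f : word -> R) (j : nat) : list nat -> R := fun ks => f (enc ks j).

Definition ldxy (a : nat) (f : word -> R) : word -> R := fun w => f (repeat lx a ++ ly :: w).

Lemma len_enc ks j : len (enc ks j) = INR (wt ks + j).
Proof.
  unfold len; f_equal; induction ks as [|a ks IH]; simpl.
  - apply repeat_length.
  - rewrite length_app, repeat_length; simpl; rewrite IH; lia.
Qed.

Lemma d1_conj_block a w : forall f, d1_conj f (repeat lx a ++ ly :: w) =
  - f (repeat lx (S a) ++ ly :: w) - f (repeat lx a ++ ly :: ly :: w) + d1_conj (ldxy a f) w.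
Proof.
  induction a as [|a IH]; intros f; [reflexivity|].
  cbn [repeat app d1_conj]; rewrite IH; reflexivity.
Qed.

Lemma theta_conj_block c a w : forall f, theta_conj c f (repeat lx a ++ ly :: w) =
  INR a * f (repeat lx (S a) ++ ly :: w)
  + (f (repeat lx a ++ ly :: lx :: w) + f (repeat lx (S a) ++ ly :: w)) / 2
  + theta_conj c (ldxy a f) w
  - c * len w * (f (repeat lx (S a) ++ ly :: w) + f (repeat lx a ++ ly :: ly :: w)).
Proof.
  induction a as [|a IH]; intros f.
  - simpl; unfold ldxy, ld; simpl; field.
  - rewrite S_INR; cbn [repeat app theta_conj]; rewrite IH.
    change (ldxy a (ld lx f)) with (ldxy (S a) f).
    unfold ld; cbn [repeat app]; field.
Qed.

Lemma theta_shift_block c a w f : theta_shift c f (repeat lx a ++ ly :: w) =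
  (INR (S a) - c * len w) * f (repeat lx (S a) ++ ly :: w) + theta_shift c (ldxy a f) w
  - c * (INR (S a) + len w) * f (ly :: repeat lx a ++ ly :: w).
Proof.
  unfold theta_shift; rewrite theta_conj_block.
  replace (len (repeat lx a ++ ly :: w)) with (INR (S a) + len w).
  - unfold ldxy; rewrite S_INR; cbn [repeat app]; field.
  - unfold len; rewrite length_app, repeat_length; simpl length.
    rewrite <- plus_INR; f_equal; lia.
Qed.

Lemma theta_conj_repeat c j : forall f, theta_conj c f (repeat lx j) = INR j * f (repeat lx (S j)).
Proof.
  induction j as [|j IH]; intros f; [simpl; ring|].
  rewrite S_INR; cbn [repeat theta_conj]; rewrite IH; unfold ld; cbn [repeat]; ring.
Qed.

Lemma fenc_ldxy a f j : fenc (ldxy a f) j = pre a (fenc f j).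
Proof. reflexivity. Qed.

(** Besides the derivation there are a harmonic product by y and a right multiplication by x. The
    latter lengthens the tail x^j, so all tails have to be treated together. *)
Lemma theta_shift_enc c ks j : forall f, theta_shift c f (enc ks j) =
  harm_der c (fenc f j) ks - c * INR j * harm_y (fenc f j) ks + (INR j + / 2) * fenc f (S j) ks.
Proof.
  induction ks as [|a ks IH]; intros f.
  - cbn [enc]; unfold theta_shift; rewrite theta_conj_repeat, harm_y_nil.
    replace (len (repeat lx j)) with (INR j) by (unfold len; now rewrite repeat_length).
    unfold fenc; simpl; field.
  - cbn [enc]; rewrite theta_shift_block, IH, len_enc, harm_der_cons, harm_y_cons, !fenc_ldxy, !plus_INR.
    unfold fenc, pre; cbn [enc repeat app]; ring.
Qed.

Lemma fenc_theta_shift c f j : fenc (theta_shift c f) j = fun ks =>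
  harm_der c (fenc f j) ks - c * INR j * harm_y (fenc f j) ks + (INR j + / 2) * fenc f (S j) ks.
Proof. apply functional_extensionality; intros ks; apply theta_shift_enc. Qed.

(** The derivation turns each y into -x y - y y, which raises the index of its block or inserts a
    block y behind it; the summand -y w inserts y in front. Together these are all terms of the
    product by y. *)
Lemma partial_conj0_enc c ks j : forall f, partial_conj c 0 f (enc ks j) = - harm_y (fenc f j) ks.
Proof.
  induction ks as [|a ks IH]; intros f; cbn [partial_conj enc].
  - rewrite harm_y_nil; unfold fenc; simpl.
    enough (E : forall g, d1_conj g (repeat lx j) = 0) by (rewrite E; ring).
    induction j as [|j IH]; intros g; [reflexivity|apply IH].
  - specialize (IH (ldxy a f)); cbn [partial_conj] in IH.
    rewrite d1_conj_block, harm_y_cons, <- fenc_ldxy.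
    assert (E : d1_conj (ldxy a f) (enc ks j) = ldxy a f (ly :: enc ks j) - harm_y (fenc (ldxy a f) j) ks)
      by lra.
    rewrite E; unfold fenc, ldxy; cbn [enc repeat app]; ring.
Qed.

(* [mult_elt c n] is pairing with the element whose harmonic multiplication is [partial_conj c n]. *)
Fixpoint mult_elt (c : R) (n : nat) (G : list nat -> R) : R :=
  match n with
  | O => - G [0%nat]
  | S n' => mult_elt c n' (harm_der c G)
  end.

Lemma mult_elt_linear c n : linear (fun (G : list nat -> R) (_ : unit) => mult_elt c n G).
Proof.
  intros k F G u; revert F G; induction n as [|n IH]; intros F G; simpl; [ring|].
  rewrite <- IH; f_equal; apply functional_extensionality; intros; apply harm_der_linear.
Qed.

Lemma mult_elt_plus c n F G : mult_elt c n (fun u => F u + G u) = mult_elt c n F + mult_elt c n G.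
Proof. exact (linear_plus _ (mult_elt_linear c n) F G tt). Qed.

Lemma mult_elt_minus c n F G : mult_elt c n (fun u => F u - G u) = mult_elt c n F - mult_elt c n G.
Proof. exact (linear_minus _ (mult_elt_linear c n) F G tt). Qed.

Lemma mult_elt_scal c n k F : mult_elt c n (fun u => k * F u) = k * mult_elt c n F.
Proof. exact (linear_scal _ (mult_elt_linear c n) k F tt). Qed.

Lemma mult_elt_harm_der c d n ks : forall F : list nat -> list nat -> R,
  mult_elt c n (fun us => harm_der d (F us) ks) = harm_der d (fun k => mult_elt c n (fun us => F us k)) ks.
Proof.
  induction ks as [|a ks IH]; intros F.
  - simpl; exact (linear_zero _ (mult_elt_linear c n) tt).
  - rewrite harm_der_cons; 
    change (pre a (fun k => mult_elt c n (fun us => F us k)))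
      with (fun k => mult_elt c n (fun us => pre a (F us) k)).
    rewrite <- (IH (fun us => pre a (F us))).
    rewrite <- !mult_elt_scal, <- mult_elt_plus, <- mult_elt_minus; reflexivity.
Qed.

Lemma mult_elt_harm_y c n ks : forall F : list nat -> list nat -> R,
  mult_elt c n (fun us => harm_y (F us) ks) = harm_y (fun k => mult_elt c n (fun us => F us k)) ks.
Proof.
  induction ks as [|a ks IH]; intros F; [reflexivity|].
  rewrite harm_y_cons; 
    change (pre a (fun k => mult_elt c n (fun us => F us k)))
      with (fun k => mult_elt c n (fun us => pre a (F us) k)).
    rewrite <- (IH (fun us => pre a (F us))).
  rewrite <- !mult_elt_plus; reflexivity.
Qed.

(** The multiplying element has no constant term: it starts from -y, and [harm_der] evaluates its
    functional at nonempty lists only. *)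
Lemma mult_elt_eq0 c n : forall G, (forall a u, G (a :: u) = 0) -> mult_elt c n G = 0.
Proof.
  assert (Dg0 : forall ks G, (forall a u, G (a :: u) = 0) -> harm_der c G ks = 0).
  { induction ks as [|a ks IH]; intros G HG; [reflexivity|].
    rewrite harm_der_cons, !HG, IH; [ring|intros; apply HG]. }
  induction n as [|n IH]; intros G HG; simpl; [rewrite HG; ring|].
  apply IH; intros; now apply Dg0.
Qed.

(** The commutator of a derivation D with multiplication by a is multiplication by D(a). The two
    other terms of [theta_shift_enc] commute with harmonic multiplication and cancel. *)
Lemma partial_conj_enc c n : forall f ks j, partial_conj c n f (enc ks j) = mult_elt c n (fun us => harm (fenc f j) us ks).
Proof.
  induction n as [|n IH]; intros f ks j.
  - rewrite partial_conj0_enc; reflexivity.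
  - cbn [partial_conj mult_elt]; rewrite IH, fenc_theta_shift, theta_shift_enc.
    assert (E : forall i, fenc (partial_conj c n f) i = fun k => mult_elt c n (fun us => harm (fenc f i) us k))
      by (intros i; apply functional_extensionality; intros k; apply IH).
    rewrite !E, <- mult_elt_harm_der, <- mult_elt_harm_y.
    rewrite <- !mult_elt_scal, <- mult_elt_minus, <- mult_elt_plus, <- mult_elt_minus.
    f_equal; apply functional_extensionality; intros us.
    rewrite harm_plus, harm_minus, !harm_scal, harm_harm_der, harm_harm_y; ring.
Qed.

(** * Reduction to functionals that vanish on harmonic products *)

Lemma enc_surj v : exists ks, v ++ [ly] = enc ks 0 /\ ks <> [].
Proof.
  induction v as [|[] v [ks [E Hk]]].
  - exists [0%nat]; split; [reflexivity|discriminate].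
  - destruct ks as [|a ks]; [congruence|].
    exists (S a :: ks); split; [simpl; now rewrite E|discriminate].
  - exists (0%nat :: ks); split; [simpl; now rewrite E|discriminate].
Qed.

Lemma enc_rcons a ks : exists v, enc (a :: ks) 0 = v ++ [ly].
Proof.
  revert a; induction ks as [|b ks IH]; intros a.
  - exists (repeat lx a); reflexivity.
  - destruct (IH b) as [v E]; exists (repeat lx a ++ ly :: v).
    change (enc (a :: b :: ks) 0) with (repeat lx a ++ ly :: enc (b :: ks) 0).
    rewrite E, <- app_assoc; reflexivity.
Qed.

Lemma phi_tr_rcons_y v : forall f, phi_tr f (v ++ [ly]) = - phi_tr (fun u => f (u ++ [ly])) v.
Proof.
  induction v as [|[] v IH]; intros f; [reflexivity| |]; cbn [app phi_tr]; rewrite !IH;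
    unfold ld; cbn [app]; ring.
Qed.

Lemma phi_tr_eq0 f v : (forall u, f u = 0) -> phi_tr f v = 0.
Proof.
  intros Hf; rewrite (functional_extensionality f (fun _ => 0) Hf).
  apply (linear_zero _ phi_tr_linear).
Qed.

Lemma is_adm_spec w : is_adm w = true -> exists v, w = lx :: v ++ [ly].
Proof.
  destruct w as [|[] w]; simpl; try discriminate.
  destruct (exists_last (l := lx :: w) ltac:(discriminate)) as [l [a E]].
  destruct l as [|b l]; simpl in E.
  - injection E; intros -> _; discriminate.
  - injection E; intros -> <-.
    exists l; destruct a; [|reflexivity].
    change (match l ++ [lx] with [] => lx | _ :: _ => last (l ++ [lx]) lx end)
      with (last (lx :: (l ++ [lx])) lx) in H.
    rewrite app_comm_cons, last_last in H; discriminate.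
Qed.

(** Stripped of its leading x and conjugated, an admissible word becomes a combination of words
    ending in y; by [partial_conj_enc] these are multiplied by an element without constant term, so
    only products of nonempty lists occur. *)
Lemma partial_tr_adm_eq0 c n f w :
  (forall us vs, us <> [] -> vs <> [] -> harm (fenc (phi_tr (ld lx f)) 0) us vs = 0) ->
  w = [] \/ is_adm w = true -> partial_tr c n f w = 0.
Proof.
  intros Hf [-> | Hw]; [apply partial_tr_nil|].
  destruct (is_adm_spec w Hw) as [v ->].
  change (ld lx (partial_tr c n f) (v ++ [ly]) = 0).
  rewrite partial_tr_ld_x, phi_tr_rcons_y, phi_tr_eq0; [ring|].
  intros u; destruct (enc_surj u) as [ks [-> Hks]].
  rewrite partial_conj_enc, mult_elt_eq0; [reflexivity|].
  intros a us; apply Hf; [discriminate|exact Hks].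
Qed.

Lemma is_adm_rcons v : is_adm (lx :: v ++ [ly]) = true.
Proof.
  unfold is_adm; rewrite app_comm_cons, last_last; reflexivity.
Qed.

(** A product with a nonempty factor consists of words ending in y. This survives phi, and the
    prefixed x makes them admissible, hence different from [u]. *)
Lemma harm_nonadm u us vs : is_adm u = false -> us <> [] ->
  harm (fenc (phi_tr (ld lx (wdelta u))) 0) us vs = 0.
Proof.
  intros Ha.
  set (F := fenc _ _).
  assert (HF : forall a ks, F (a :: ks) = 0).
  { intros a ks; unfold F, fenc.
    destruct (enc_rcons a ks) as [v ->]; rewrite phi_tr_rcons_y, phi_tr_eq0; [ring|].
    intros w; unfold ld, wdelta.
    destruct word_eq_dec as [e|]; [|reflexivity].
    rewrite <- e, is_adm_rcons in Ha; discriminate. }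
  clearbody F; clear Ha; revert F HF.
  pattern us, vs; apply list_pair_ind; clear us vs.
  - intros vs F _ Hus; congruence.
  - intros a u' F HF _; apply HF.
  - intros a u' b v _ _ _ F HF _; rewrite harm_cons.
    assert (E : forall d, pre d F = fun _ => 0)
      by (intros d; apply functional_extensionality; intros k; apply HF).
    assert (E0 : forall us vs, harm (fun _ => 0) us vs = 0)
      by (intros; exact (linear_zero _ (harm_linear_l _) _)).
    rewrite !E, !E0; ring.
Qed.

(** * Growth estimates *)

(* A stand-in for k^(1/4) whose increments are explicit. *)
Fixpoint qpow (k : nat) : R :=
  match k with
  | O => 1
  | S k' => qpow k' * (1 + / (4 * INR (S k')))
  end.

Lemma INR_S_pos k : 0 < INR (S k).
Proof. apply lt_0_INR; lia. Qed.

Lemma qpow_S k : qpow (S k) = qpow k + qpow k / (4 * INR (S k)).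
Proof. cbn [qpow]; field; pose proof (INR_S_pos k); lra. Qed.

Lemma qpow_ge1 k : 1 <= qpow k.
Proof.
  induction k as [|k IH]; [simpl; lra|].
  rewrite qpow_S; pose proof (INR_S_pos k).
  assert (0 <= qpow k / (4 * INR (S k))) by (apply Rdiv_le_0_compat; lra); lra.
Qed.

Lemma qpow_incr k : qpow k <= qpow (S k).
Proof.
  rewrite qpow_S; pose proof (INR_S_pos k); pose proof (qpow_ge1 k).
  assert (0 <= qpow k / (4 * INR (S k))) by (apply Rdiv_le_0_compat; lra); lra.
Qed.

Lemma qpow_mono k m : (k <= m)%nat -> qpow k <= qpow m.
Proof.
  induction 1 as [|m _ IH]; [lra|]. pose proof (qpow_incr m); lra.
Qed.

Lemma qpow_S_le k : qpow (S k) <= 5 / 4 * qpow k.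
Proof.
  cbn [qpow]; pose proof (qpow_ge1 k).
  assert (/ (4 * INR (S k)) <= / 4).
  { apply Rinv_le_contravar; [lra|]. rewrite S_INR; pose proof (pos_INR k); lra. }
  nra.
Qed.

(** Each step uses (1 + t/4)^3 <= 1 + t for 0 <= t <= 1, with t = 1/(k + 1). *)
Lemma qpow_cube k : qpow k ^ 3 <= INR (S k).
Proof.
  induction k as [|k IH]; [simpl; lra|].
  cbn [qpow]; rewrite Rpow_mult_distr.
  pose proof (INR_S_pos k) as Hk; set (t := / INR (S k)).
  assert (Ht : 0 < t <= 1).
  { split; [apply Rinv_0_lt_compat; lra|].
    unfold t; rewrite <- Rinv_1; apply Rinv_le_contravar; [lra|].
    rewrite S_INR; pose proof (pos_INR k); lra. }
  assert (E : / (4 * INR (S k)) = t / 4) by (unfold t; field; lra).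
  assert (E2 : INR (S (S k)) = INR (S k) * (1 + t)).
  { rewrite (S_INR (S k)); unfold t; field; lra. }
  rewrite E, E2; clear E E2.
  assert (H0 : 0 <= qpow k ^ 3) by (apply pow_le; pose proof (qpow_ge1 k); lra).
  apply Rmult_le_compat; auto.
  - apply pow_le; lra.
  - nra.
Qed.

(** Plays the role of k^(-1/2): it tends to 0, and its quotient by k is summable. *)
Definition decay (k : nat) : R := qpow k ^ 2 / INR k.

Lemma decay_pos k : 0 < decay (S k).
Proof.
  unfold decay; pose proof (qpow_ge1 (S k)); pose proof (INR_S_pos k).
  apply Rdiv_lt_0_compat; [apply pow_lt|]; lra.
Qed.

(** The decrements of k^(-1/2) are of order k^(-3/2); the constant 10 leaves room for small k. *)
Lemma decay_telescope k : decay (S k) / INR (S k) <= 10 * (decay (S k) - decay (S (S k))).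
Proof.
  unfold decay; cbn [qpow]; rewrite (S_INR (S k)).
  set (s := qpow k * (1 + / (4 * INR (S k)))).
  assert (Hx : 1 <= INR (S k)) by (rewrite S_INR; pose proof (pos_INR k); lra).
  set (x := INR (S k)) in *.
  replace (10 * (s ^ 2 / x - (s * (1 + / (4 * (x + 1)))) ^ 2 / (x + 1)))
    with (s ^ 2 * (10 * (/ x - (1 + / (4 * (x + 1))) ^ 2 / (x + 1)))) by (field; lra).
  replace (s ^ 2 / x / x) with (s ^ 2 * / (x * x)) by (field; lra).
  apply Rmult_le_compat_l; [apply pow2_ge_0|].
  replace (10 * (/ x - (1 + / (4 * (x + 1))) ^ 2 / (x + 1))) with
    (/ (x * x) + (10 * (16 * (x + 1) ^ 3 * x - (4 * (x + 1) + 1) ^ 2 * x * x) - 16 * (x + 1) ^ 3)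
      / (16 * (x + 1) ^ 3 * (x * x))) by (field; lra).
  assert (0 <= (10 * (16 * (x + 1) ^ 3 * x - (4 * (x + 1) + 1) ^ 2 * x * x) - 16 * (x + 1) ^ 3)
      / (16 * (x + 1) ^ 3 * (x * x))); [|lra].
  apply Rdiv_le_0_compat.
  - nra.
  - assert (0 < (x + 1) ^ 3) by (apply pow_lt; lra). assert (0 < x * x) by nra. nra.
Qed.

Lemma decay_decr k m : (k <= m)%nat -> decay (S m) <= decay (S k).
Proof.
  induction 1 as [|m _ IH]; [lra|].
  pose proof (decay_telescope m); pose proof (decay_pos m); pose proof (INR_S_pos m).
  assert (0 < decay (S m) / INR (S m)) by (apply Rdiv_lt_0_compat; lra); lra.
Qed.

Lemma decay_lim : is_lim_seq (fun k => decay (S k)) 0.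
Proof.
  apply is_lim_seq_spec; intros eps; pose proof (cond_pos eps) as He.
  (* By [qpow_cube], the cube of [decay k] is at most (k + 1)^2 / k^3 <= 4 / k. *)
  destruct (archimed_cor1 (eps ^ 3 / 4)) as [N [HN1 HN2]]; [assert (0 < eps ^ 3) by (apply pow_lt; lra); lra|].
  exists N; intros n Hn.
  rewrite Rminus_0_r, Rabs_pos_eq by (left; apply decay_pos).
  destruct (Rlt_le_dec (decay (S n)) eps) as [|Hle]; [assumption|exfalso].
  assert (H1 : eps ^ 3 <= decay (S n) ^ 3) by (apply pow_incr; lra).
  assert (H2 : decay (S n) ^ 3 <= 4 / INR (S n)).
  { unfold decay; pose proof (qpow_cube (S n)) as Hc; pose proof (INR_S_pos n) as Hp.
    rewrite S_INR in Hc.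
    assert (H1x : 1 <= INR (S n)) by (rewrite S_INR; pose proof (pos_INR n); lra).
    set (x := INR (S n)) in *; set (s := qpow (S n)) in *.
    assert (Hs : 0 <= s ^ 3) by (apply pow_le; unfold s; pose proof (qpow_ge1 (S n)); lra).
    replace ((s ^ 2 / x) ^ 3) with ((s ^ 3) ^ 2 / x ^ 3) by (field; lra).
    replace (4 / x) with (4 * x ^ 2 / x ^ 3) by (field; lra).
    apply Rmult_le_compat_r; [left; apply Rinv_0_lt_compat, pow_lt; lra|].
    nra. }
  assert (H3 : / INR (S n) <= / INR N).
  { apply Rinv_le_contravar; [apply lt_0_INR; lia|apply le_INR; lia]. }
  unfold Rdiv in *; lra.
Qed.

Lemma ex_series_Rabs_le (u b : nat -> R) :
  (forall n, Rabs (u n) <= b n) -> ex_series b -> ex_series u.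
Proof. exact (@ex_series_le R_AbsRing R_CompleteNormedModule u b). Qed.

Lemma decay_summable : ex_series (fun k => decay (S k) / INR (S k)).
Proof.
  apply (ex_series_Rabs_le _ (fun k => 10 * (decay (S k) - decay (S (S k))))).
  - intros k; pose proof (decay_pos k); pose proof (INR_S_pos k).
    assert (0 < decay (S k) / INR (S k)) by (apply Rdiv_lt_0_compat; lra).
    rewrite Rabs_pos_eq by lra; apply decay_telescope.
  - apply (ex_series_scal_l 10 (fun k => decay (S k) - decay (S (S k)))).
    exists (decay 1 - 0).
    change (is_lim_seq (sum_n (fun k => decay (S k) - decay (S (S k)))) (decay 1 - 0)).
    apply (is_lim_seq_ext (fun n => decay 1 - decay (S (S n)))).
    + induction n as [|n IH]; [now rewrite sum_O|].
      rewrite sum_Sn, <- IH; unfold plus; simpl; ring.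
    + apply is_lim_seq_minus'; [apply is_lim_seq_const|].
      apply (is_lim_seq_incr_1 (fun k => decay (S k))), decay_lim.
Qed.

Lemma Series_zero : Series (fun _ => 0) = 0.
Proof.
  transitivity (Series (fun _ => 0 * 0)); [apply Series_ext; intros; ring|].
  rewrite Series_scal_l; ring.
Qed.

(** Dominated convergence: beyond a cut [M] the tail of [b] is below eps/2, and the finitely many
    terms before it tend to 0. *)
Lemma tannery (a : nat -> nat -> R) (b : nat -> R) :
  (forall n m, 0 <= a n m <= b m) -> ex_series b ->
  (forall m, is_lim_seq (fun n => a n m) 0) ->
  is_lim_seq (fun n => Series (a n)) 0.
Proof.
  intros Hab Hb Hlim.
  assert (Ha : forall n, ex_series (a n)).
  { intros n; apply (ex_series_Rabs_le (a n) b); [|exact Hb].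
    intros m; rewrite Rabs_pos_eq; apply Hab. }
  apply is_lim_seq_spec; intros eps.
  destruct Hb as [l Hl]; change R in l.
  assert (Hl' : is_lim_seq (sum_n b) l) by exact Hl; apply is_lim_seq_spec in Hl'.
  destruct (Hl' (pos_div_2 eps)) as [M HM]; specialize (HM M (Nat.le_refl _)); simpl in HM.
  assert (Hfin : is_lim_seq (fun n => sum_n (a n) M) 0).
  { clear HM; induction M as [|M IH].
    - apply (is_lim_seq_ext (fun n => a n 0%nat)); [intros n; now rewrite sum_O|apply Hlim].
    - apply (is_lim_seq_ext (fun n => sum_n (a n) M + a n (S M)));
        [intros n; now rewrite sum_Sn|].
      replace 0 with (0 + 0) by ring; now apply is_lim_seq_plus'. }
  apply is_lim_seq_spec in Hfin; destruct (Hfin (pos_div_2 eps)) as [N HN].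
  exists N; intros n Hn; specialize (HN n Hn); simpl in HN.
  rewrite Rminus_0_r in *.
  assert (E : forall u : nat -> R, ex_series u -> Series u = sum_n u M + Series (fun k => u (S M + k)%nat)).
  { intros u Hu; rewrite (Series_incr_n u (S M)); [|lia|exact Hu].
    simpl pred; now rewrite sum_n_Reals. }
  assert (Hb : ex_series b) by (now exists l).
  assert (El := is_series_unique _ _ Hl).
  rewrite (E b Hb) in El; rewrite (E (a n) (Ha n)).
  assert (Ht : 0 <= Series (fun k => a n (S M + k)%nat) <= Series (fun k => b (S M + k)%nat)).
  { split.
    - replace 0 with (Series (fun _ => 0)) by apply Series_zero.
      apply Series_le; [intros k; split; [lra|apply Hab]|].
      now apply (ex_series_incr_n (a n) (S M)).
    - apply Series_le; [intros k; apply Hab|].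
      now apply (ex_series_incr_n b (S M)). }
  apply Rabs_def2 in HM; apply Rabs_def2 in HN; apply Rabs_def1; lra.
Qed.

(** * Newton coefficients of multiple harmonic sums *)

(* The value -1 at m = 0 for the empty word makes S_w(n) = - [newton_diff w n 0] for all [w]. *)
Fixpoint newton (w : word) (m : nat) : R :=
  match w, m with
  | [], O => -1
  | [], S _ => 0
  | _ :: _, O => 0
  | lx :: w', S _ => / INR m * sumR (fun i => newton w' (S i)) m
  | ly :: w', S _ => - (/ INR m * sumR (newton w') m)
  end.

Lemma newton_x w m :
  INR (S m) * newton (lx :: w) (S m) = INR m * newton (lx :: w) m + newton w (S m).
Proof.
  pose proof (INR_S_pos m).
  destruct m as [|m]; cbn [newton sumR]; [simpl; field|].
  pose proof (INR_S_pos m); field; lra.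
Qed.

Lemma newton_y w m :
  INR (S m) * newton (ly :: w) (S m) = INR m * newton (ly :: w) m - newton w m.
Proof.
  pose proof (INR_S_pos m).
  destruct m as [|m]; cbn [newton sumR]; [simpl; field|].
  pose proof (INR_S_pos m); field; lra.
Qed.

Fixpoint newton_diff (w : word) (n m : nat) : R :=
  match n with
  | O => newton w m
  | S n' => newton_diff w n' m - newton_diff w n' (S m)
  end.

(** Row n = 0 is [newton_x], and each difference raises the factor on the left by one. Column m = 0
    is the recursion of harmonic sums in n, which proves the Newton expansion. *)
Lemma newton_diff_x w n : forall m, INR (n + S m) * newton_diff (lx :: w) n (S m) =
  INR m * newton_diff (lx :: w) n m + newton_diff w n (S m).
Proof.
  induction n as [|n IH]; intros m; [apply newton_x|].
  cbn [newton_diff].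
  pose proof (IH m) as E1; pose proof (IH (S m)) as E2.
  rewrite !plus_INR, !S_INR in *.
  replace ((INR n + 1 + (INR m + 1)) * (newton_diff (lx :: w) n (S m) - newton_diff (lx :: w) n (S (S m))))
    with ((INR n + (INR m + 1)) * newton_diff (lx :: w) n (S m) + newton_diff (lx :: w) n (S m)
          - (INR n + (INR m + 1 + 1)) * newton_diff (lx :: w) n (S (S m))) by ring.
  rewrite E1, E2; ring.
Qed.

Lemma newton_diff_y w n : forall m, INR (n + S m) * newton_diff (ly :: w) n (S m) =
  INR m * newton_diff (ly :: w) n m - newton_diff w n m.
Proof.
  induction n as [|n IH]; intros m; [apply newton_y|].
  cbn [newton_diff].
  pose proof (IH m) as E1; pose proof (IH (S m)) as E2.
  rewrite !plus_INR, !S_INR in *.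
  replace ((INR n + 1 + (INR m + 1)) * (newton_diff (ly :: w) n (S m) - newton_diff (ly :: w) n (S (S m))))
    with ((INR n + (INR m + 1)) * newton_diff (ly :: w) n (S m) + newton_diff (ly :: w) n (S m)
          - (INR n + (INR m + 1 + 1)) * newton_diff (ly :: w) n (S (S m))) by ring.
  rewrite E1, E2; ring.
Qed.

Lemma newton_diff_nil_S n : forall m, newton_diff [] n (S m) = 0.
Proof. induction n as [|n IH]; intros m; [reflexivity|]. cbn [newton_diff]; rewrite !IH; ring. Qed.

Lemma newton_diff_nil_0 n : newton_diff [] n 0 = -1.
Proof. induction n as [|n IH]; [reflexivity|]. cbn [newton_diff]; rewrite IH, newton_diff_nil_S; ring. Qed.

(** [qpow] absorbs the powers of the logarithm by which harmonic sums grow. *)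
Definition newton_diff_bound (X : nat -> nat -> R) (C : R) : Prop :=
  0 <= C /\ (forall n m, Rabs (X n (S m)) <= C * qpow (n + S m) / INR (n + S m))
  /\ (forall n, Rabs (X n 0%nat) <= C * qpow n).

Lemma newton_diff_bound_step (X r : nat -> nat -> R) (K : R) : 0 <= K ->
  (forall n m, INR (n + S m) * X n (S m) = INR m * X n m + r n m) ->
  X 0%nat 0%nat = 0 ->
  (forall n, X (S n) 0%nat = X n 0%nat - X n 1%nat) ->
  (forall n, Rabs (r n 0%nat) <= K * qpow (n + 1)) ->
  (forall n m, Rabs (r n (S m)) <= K * qpow (n + S m) / INR (n + S (S m))) ->
  newton_diff_bound X (20 * K).
Proof.
  intros HK Hrec H00 H0S Hr0 HrS.
  (* The increment of 4 K [qpow] is exactly the bound assumed for [r n (S m)]. *)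
  assert (HX : forall n m, Rabs (X n (S m)) <= 4 * K * qpow (n + S m) / INR (n + S m)).
  { intros n; induction m as [|m IH].
    - specialize (Hrec n 0%nat); specialize (Hr0 n).
      rewrite Nat.add_1_r in *; pose proof (INR_S_pos n) as Hp.
      replace (X n 1%nat) with (r n 0%nat / INR (S n))
        by (apply (Rmult_eq_reg_l (INR (S n))); [rewrite Hrec; simpl (INR 0); field|]; lra).
      unfold Rdiv; rewrite Rabs_mult, (Rabs_pos_eq (/ _))
        by (left; now apply Rinv_0_lt_compat).
      apply Rmult_le_compat_r; [left; now apply Rinv_0_lt_compat|].
      pose proof (qpow_ge1 (S n)); nra.
    - specialize (Hrec n (S m)); specialize (HrS n m).
      rewrite (Nat.add_succ_r n (S m)) in *.
      rewrite (Nat.add_succ_r n m) in *.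
      set (k := (n + m)%nat) in *.
      assert (Hk1 := INR_S_pos k); assert (Hk2 := INR_S_pos (S k)).
      assert (Hs1 := qpow_ge1 (S k)).
      replace (X n (S (S m))) with ((INR (S m) * X n (S m) + r n (S m)) / INR (S (S k)))
        by (rewrite <- Hrec; field; lra).
      unfold Rdiv; rewrite Rabs_mult, (Rabs_pos_eq (/ INR (S (S k))))
        by (left; now apply Rinv_0_lt_compat).
      apply Rmult_le_compat_r; [left; now apply Rinv_0_lt_compat|].
      eapply Rle_trans; [apply Rabs_triang|].
      rewrite Rabs_mult, (Rabs_pos_eq (INR (S m))) by apply pos_INR.
      assert (Hm : INR (S m) * Rabs (X n (S m)) <= 4 * K * qpow (S k)).
      { apply Rle_trans with (INR (S k) * (4 * K * qpow (S k) / INR (S k))).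
        - apply Rmult_le_compat; auto using pos_INR, Rabs_pos.
          apply le_INR; lia.
        - right; field; lra. }
      rewrite (qpow_S (S k)).
      replace (4 * K * (qpow (S k) + qpow (S k) / (4 * INR (S (S k)))))
        with (4 * K * qpow (S k) + K * qpow (S k) / INR (S (S k))) by (field; lra).
      lra. }
  repeat split; [lra| |].
  - intros n m; eapply Rle_trans; [apply HX|].
    apply Rmult_le_compat_r; [left; apply Rinv_0_lt_compat, lt_0_INR; lia|].
    pose proof (qpow_ge1 (n + S m)); nra.
  (* In column 0 the differences add up over n; each is at most 5 K qpow(n) / (n + 1), the increment
     of 20 K [qpow]. *)
  - induction n as [|n IH].
    + rewrite H00, Rabs_R0; pose proof (qpow_ge1 0); nra.
    + rewrite H0S; unfold Rminus; eapply Rle_trans; [apply Rabs_triang|].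
      rewrite Rabs_Ropp; specialize (HX n 0%nat); rewrite Nat.add_1_r in HX.
      pose proof (INR_S_pos n) as Hp; pose proof (qpow_S_le n) as Hs.
      assert (4 * K * qpow (S n) / INR (S n) <= 5 * K * qpow n / INR (S n)).
      { apply Rmult_le_compat_r; [left; now apply Rinv_0_lt_compat|nra]. }
      rewrite (qpow_S n).
      replace (20 * K * (qpow n + qpow n / (4 * INR (S n))))
        with (20 * K * qpow n + 5 * K * qpow n / INR (S n)) by (field; lra).
      lra.
Qed.

Lemma newton_diff_bounded w : exists C, newton_diff_bound (newton_diff w) C.
Proof.
  induction w as [|[] w [C [HC [H1 H2]]]].
  - exists 1; repeat split; [lra| |].
    + intros n m; rewrite newton_diff_nil_S, Rabs_R0, Rmult_1_l; pose proof (qpow_ge1 (n + S m)).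
      apply Rdiv_le_0_compat; [lra|apply lt_0_INR; lia].
    + intros n; rewrite newton_diff_nil_0, Rabs_left by lra; pose proof (qpow_ge1 n); lra.
  - exists (20 * (2 * C)).
    apply (newton_diff_bound_step _ (fun n m => newton_diff w n (S m))); [lra|apply newton_diff_x|reflexivity|reflexivity| |].
    + intros n; eapply Rle_trans; [apply H1|].
      rewrite Nat.add_1_r; pose proof (qpow_ge1 (S n)); pose proof (INR_S_pos n).
      apply (Rmult_le_reg_r (INR (S n))); [assumption|].
      unfold Rdiv; rewrite Rmult_assoc, Rinv_l, Rmult_1_r by lra.
      assert (1 <= INR (S n)) by (rewrite S_INR; pose proof (pos_INR n); lra).
      assert (0 <= C * qpow (S n)) by nra. nra.
    + intros n m; eapply Rle_trans; [apply H1|].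
      rewrite (Nat.add_succ_r n (S m)).
      apply Rmult_le_compat_r; [left; apply Rinv_0_lt_compat, INR_S_pos|].
      pose proof (qpow_S_le (n + S m)); pose proof (qpow_ge1 (n + S m)); nra.
  - exists (20 * (2 * C)).
    apply (newton_diff_bound_step _ (fun n m => - newton_diff w n m)); [lra| |reflexivity|reflexivity| |].
    + intros n m; rewrite newton_diff_y; ring.
    + intros n; rewrite Rabs_Ropp; eapply Rle_trans; [apply H2|].
      rewrite Nat.add_1_r; pose proof (qpow_incr n); pose proof (qpow_ge1 n); nra.
    + intros n m; rewrite Rabs_Ropp; eapply Rle_trans; [apply H1|].
      rewrite (Nat.add_succ_r n (S m)), (Nat.add_succ_r n m).
      set (k := (n + m)%nat); rewrite (S_INR (S k)).
      assert (1 <= INR (S k)) by (rewrite S_INR; pose proof (pos_INR k); lra).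
      pose proof (qpow_ge1 (S k)).
      replace (C * qpow (S k) / INR (S k))
        with (2 * C * qpow (S k) / (2 * INR (S k))) by (field; lra).
      unfold Rdiv; apply Rmult_le_compat_l; [nra|].
      apply Rinv_le_contravar; lra.
Qed.

(** The factor [qpow n] makes room for the growth of a second sum in [kaw_dkaw_lim]. *)
Lemma newton_diff_le_decay w : exists C, 0 <= C /\
  forall n m, Rabs (newton_diff w n (S m)) * qpow n <= C * decay (S (n + m)).
Proof.
  destruct (newton_diff_bounded w) as [C [HC [H1 _]]]; exists C; split; [exact HC|].
  intros n m; specialize (H1 n m); rewrite Nat.add_succ_r in H1.
  set (k := S (n + m)) in *.
  pose proof (qpow_ge1 n); pose proof (qpow_ge1 k).
  assert (qpow n <= qpow k) by (apply qpow_mono; unfold k; lia).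
  apply Rle_trans with (C * qpow k / INR k * qpow k).
  - apply Rmult_le_compat; [apply Rabs_pos|lra|exact H1|assumption].
  - right; unfold decay; field; apply not_0_INR; unfold k; lia.
Qed.

Lemma newton_diff_lim w n : is_lim_seq (fun m => newton_diff w n (S m)) 0.
Proof.
  destruct (newton_diff_le_decay w) as [C [HC H]].
  apply is_lim_seq_abs_0.
  apply (is_lim_seq_le_le (fun _ => 0) _ (fun m => C * decay (S (m + n)))).
  - intros m; split; [apply Rabs_pos|].
    specialize (H n m); rewrite (Nat.add_comm n m) in H.
    pose proof (qpow_ge1 n); pose proof (Rabs_pos (newton_diff w n (S m))); nra.
  - apply is_lim_seq_const.
  - replace (Finite 0) with (Rbar_mult C 0) by (simpl; f_equal; ring).
    apply (is_lim_seq_scal_l (fun m => decay (S (m + n))) C 0).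
    apply (is_lim_seq_incr_n (fun m => decay (S m))), decay_lim.
Qed.

(** * Kawashima functions and their derivatives at the integers *)

Definition newton_term (w : word) (n m : nat) : R := newton_diff w n (S m) / INR (S m).

Lemma newton_term_summable w n : ex_series (newton_term w n).
Proof.
  destruct (newton_diff_le_decay w) as [C [HC H]].
  apply (ex_series_Rabs_le _ (fun m => C * (decay (S m) / INR (S m)))).
  - intros m; unfold newton_term, Rdiv; pose proof (INR_S_pos m).
    rewrite Rabs_mult, (Rabs_pos_eq (/ _)) by (left; now apply Rinv_0_lt_compat).
    rewrite <- Rmult_assoc; apply Rmult_le_compat_r; [left; now apply Rinv_0_lt_compat|].
    specialize (H n m).
    assert (decay (S (n + m)) <= decay (S m)) by (apply decay_decr; lia).
    pose proof (qpow_ge1 n); pose proof (Rabs_pos (newton_diff w n (S m))); nra.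
  - apply (ex_series_scal_l C (fun m => decay (S m) / INR (S m))), decay_summable.
Qed.

(* The values at n of the Kawashima function of [w] and of its derivative. *)
Definition kaw (w : word) (n : nat) : R := - newton_diff w n 0.
Definition dkaw (w : word) (n : nat) : R := Series (newton_term w n).

(** The growth of [kaw v n] is absorbed term by term by [newton_diff_le_decay], and dominated
    convergence applies. An empty [v] gives the decay of [dkaw w] itself. *)
Lemma kaw_dkaw_lim v w : is_lim_seq (fun n => kaw v n * dkaw w n) 0.
Proof.
  destruct (newton_diff_bounded v) as [C1 [HC1 [_ H1]]].
  destruct (newton_diff_le_decay w) as [C [HC H]].
  apply is_lim_seq_abs_0.
  apply (is_lim_seq_le_le (fun _ => 0) _
    (fun n => Series (fun m => C1 * C * (decay (S (n + m)) / INR (S m))))).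
  - intros n; split; [apply Rabs_pos|].
    unfold dkaw; rewrite <- Series_scal_l.
    assert (Hle : forall m, 0 <= Rabs (kaw v n * newton_term w n m) <= C1 * C * (decay (S (n + m)) / INR (S m))).
    { intros m; split; [apply Rabs_pos|]; unfold newton_term, Rdiv, kaw.
      pose proof (INR_S_pos m); rewrite <- !Rmult_assoc.
      rewrite Rabs_mult, (Rabs_pos_eq (/ _)) by (left; now apply Rinv_0_lt_compat).
      apply Rmult_le_compat_r; [left; now apply Rinv_0_lt_compat|].
      rewrite Rabs_mult, Rabs_Ropp.
      specialize (H1 n); specialize (H n m).
      pose proof (Rabs_pos (newton_diff w n (S m))).
      apply Rle_trans with (C1 * qpow n * Rabs (newton_diff w n (S m))); [nra|].
      replace (C1 * qpow n * Rabs (newton_diff w n (S m))) with (C1 * (Rabs (newton_diff w n (S m)) * qpow n)) by ring.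
      rewrite Rmult_assoc; now apply Rmult_le_compat_l. }
    assert (Hs : ex_series (fun m => C1 * C * (decay (S (n + m)) / INR (S m)))).
    { apply (ex_series_scal_l (C1 * C) (fun m => decay (S (n + m)) / INR (S m))).
      apply (ex_series_Rabs_le _ (fun m => decay (S m) / INR (S m))); [|exact decay_summable].
      intros m; pose proof (INR_S_pos m); pose proof (decay_pos (n + m)).
      rewrite Rabs_pos_eq by (apply Rdiv_le_0_compat; lra).
      apply Rmult_le_compat_r; [left; now apply Rinv_0_lt_compat|apply decay_decr; lia]. }
    eapply Rle_trans; [apply Series_Rabs|apply Series_le; assumption].
    apply (ex_series_Rabs_le _ _) with (2 := Hs).
    intros m; rewrite Rabs_Rabsolu; apply Hle.
  - apply is_lim_seq_const.
  - apply (is_lim_seq_ext (fun n => C1 * C * Series (fun m => decay (S (n + m)) / INR (S m)))).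
    { intros n; now rewrite Series_scal_l. }
    replace (Finite 0) with (Rbar_mult (C1 * C) 0) by (simpl; f_equal; ring).
    apply is_lim_seq_scal_l.
    apply (tannery _ (fun m => decay (S m) / INR (S m))); [|exact decay_summable|].
    + intros n m; pose proof (INR_S_pos m); pose proof (decay_pos (n + m)).
      split; [apply Rdiv_le_0_compat; lra|].
      apply Rmult_le_compat_r; [left; now apply Rinv_0_lt_compat|apply decay_decr; lia].
    + intros m; unfold Rdiv.
      replace (Finite 0) with (Rbar_mult 0 (/ INR (S m))) by (simpl; f_equal; ring).
      apply (is_lim_seq_scal_r (fun n => decay (S (n + m)))).
      apply (is_lim_seq_incr_n (fun n => decay (S n))), decay_lim.
Qed.

Lemma kaw_nil n : kaw [] n = 1.
Proof. unfold kaw; rewrite newton_diff_nil_0; ring. Qed.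

Lemma dkaw_nil n : dkaw [] n = 0.
Proof.
  unfold dkaw; rewrite <- Series_zero; apply Series_ext; intros m.
  unfold newton_term; rewrite newton_diff_nil_S; unfold Rdiv; ring.
Qed.

Lemma kaw_cons_0 a w : kaw (a :: w) 0 = 0.
Proof. unfold kaw; destruct a; simpl; ring. Qed.

Lemma kaw_S w n : kaw w (S n) - kaw w n = newton_diff w n 1.
Proof. unfold kaw; cbn [newton_diff]; ring. Qed.

Lemma kaw_x w n : kaw (lx :: w) (S n) - kaw (lx :: w) n = / INR (S n) * (kaw w (S n) - kaw w n).
Proof.
  rewrite !kaw_S; pose proof (newton_diff_x w n 0) as E; rewrite Nat.add_1_r in E; simpl (INR 0) in E.
  pose proof (INR_S_pos n).
  apply (Rmult_eq_reg_l (INR (S n))); [rewrite E; field|]; lra.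
Qed.

Lemma kaw_y w n : kaw (ly :: w) (S n) - kaw (ly :: w) n = / INR (S n) * kaw w n.
Proof.
  rewrite !kaw_S; pose proof (newton_diff_y w n 0) as E; rewrite Nat.add_1_r in E; simpl (INR 0) in E.
  pose proof (INR_S_pos n); unfold kaw.
  apply (Rmult_eq_reg_l (INR (S n))); [rewrite E; field|]; lra.
Qed.

Lemma is_series_dkaw w n : is_series (newton_term w n) (dkaw w n).
Proof. apply Series_correct, newton_term_summable. Qed.

Lemma is_series_dkaw_diff w n :
  is_series (fun m => - (newton_diff w n (S (S m)) / INR (S m))) (dkaw w (S n) - dkaw w n).
Proof.
  apply (is_series_ext (fun m => newton_term w (S n) m - newton_term w n m)).
  - intros m; change (newton_term w (S n) m - newton_term w n m = - (newton_diff w n (S (S m)) / INR (S m))).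
    unfold newton_term; cbn [newton_diff]; field; pose proof (INR_S_pos m); lra.
  - exact (is_series_minus _ _ _ _ (is_series_dkaw w (S n)) (is_series_dkaw w n)).
Qed.

Lemma is_series_newton_diff_telescope w n :
  is_series (fun m => newton_diff w n (S (S m)) - newton_diff w n (S m)) (- newton_diff w n 1).
Proof.
  change (is_lim_seq (sum_n (fun m => newton_diff w n (S (S m)) - newton_diff w n (S m))) (- newton_diff w n 1)).
  apply (is_lim_seq_ext (fun m => newton_diff w n (S (S m)) - newton_diff w n 1)).
  - induction n0 as [|m IH]; [now rewrite sum_O|].
    rewrite sum_Sn, <- IH; unfold plus; simpl; ring.
  - replace (- newton_diff w n 1) with (0 - newton_diff w n 1) by ring.
    apply is_lim_seq_minus'; [|apply is_lim_seq_const].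
    apply (is_lim_seq_incr_1 (fun m => newton_diff w n (S m))), newton_diff_lim.
Qed.

Lemma is_series_inj (a : nat -> R) (l1 l2 : R) : is_series a l1 -> is_series a l2 -> l1 = l2.
Proof. intros H1 H2; now rewrite <- (is_series_unique _ _ H1), (is_series_unique _ _ H2). Qed.

(** The eps-coefficient of [kaw_x] with n + 1 replaced by n + 1 + eps. Dividing [newton_diff_x] by
    its factor [INR m], at positive m, and summing leaves a telescoping series, which yields the
    [kaw] term. *)
Lemma dkaw_x w n : dkaw (lx :: w) (S n) - dkaw (lx :: w) n =
  / INR (S n) * ((dkaw w (S n) - dkaw w n) - (kaw (lx :: w) (S n) - kaw (lx :: w) n)).
Proof.
  pose proof (INR_S_pos n).
  apply (Rmult_eq_reg_l (INR (S n))); [|lra].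
  rewrite <- Rmult_assoc, Rinv_r, Rmult_1_l, kaw_S by lra.
  apply (is_series_inj (fun m => INR (S n) * - (newton_diff (lx :: w) n (S (S m)) / INR (S m)))).
  { exact (is_series_scal_l (INR (S n)) _ _ (is_series_dkaw_diff (lx :: w) n)). }
  replace ((dkaw w (S n) - dkaw w n) - newton_diff (lx :: w) n 1) with (- newton_diff (lx :: w) n 1 + (dkaw w (S n) - dkaw w n)) by ring.
  eapply is_series_ext;
    [|exact (is_series_plus _ _ _ _ (is_series_newton_diff_telescope (lx :: w) n) (is_series_dkaw_diff w n))].
  intros m; change (newton_diff (lx :: w) n (S (S m)) - newton_diff (lx :: w) n (S m)
    + - (newton_diff w n (S (S m)) / INR (S m)) = INR (S n) * - (newton_diff (lx :: w) n (S (S m)) / INR (S m))).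
  pose proof (newton_diff_x w n (S m)) as E; pose proof (INR_S_pos m).
  replace (newton_diff w n (S (S m))) with (INR (n + S (S m)) * newton_diff (lx :: w) n (S (S m))
    - INR (S m) * newton_diff (lx :: w) n (S m)) by lra.
  rewrite plus_INR, (S_INR (S m)), (S_INR n); field; lra.
Qed.

Lemma dkaw_y w n : dkaw (ly :: w) (S n) - dkaw (ly :: w) n =
  / INR (S n) * (dkaw w n - (kaw (ly :: w) (S n) - kaw (ly :: w) n)).
Proof.
  pose proof (INR_S_pos n).
  apply (Rmult_eq_reg_l (INR (S n))); [|lra].
  rewrite <- Rmult_assoc, Rinv_r, Rmult_1_l, kaw_S by lra.
  apply (is_series_inj (fun m => INR (S n) * - (newton_diff (ly :: w) n (S (S m)) / INR (S m)))).
  { exact (is_series_scal_l (INR (S n)) _ _ (is_series_dkaw_diff (ly :: w) n)). }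
  replace (dkaw w n - newton_diff (ly :: w) n 1) with (- newton_diff (ly :: w) n 1 + dkaw w n) by ring.
  eapply is_series_ext;
    [|exact (is_series_plus _ _ _ _ (is_series_newton_diff_telescope (ly :: w) n) (is_series_dkaw w n))].
  intros m; change (newton_diff (ly :: w) n (S (S m)) - newton_diff (ly :: w) n (S m)
    + newton_diff w n (S m) / INR (S m) = INR (S n) * - (newton_diff (ly :: w) n (S (S m)) / INR (S m))).
  pose proof (newton_diff_y w n (S m)) as E; pose proof (INR_S_pos m).
  replace (newton_diff w n (S m)) with (INR (S m) * newton_diff (ly :: w) n (S m)
    - INR (n + S (S m)) * newton_diff (ly :: w) n (S (S m))) by lra.
  rewrite plus_INR, (S_INR (S m)), (S_INR n); field; lra.
Qed.

Lemma kaw_block a w n : kaw (repeat lx a ++ ly :: w) (S n) - kaw (repeat lx a ++ ly :: w) n =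
  (/ INR (S n)) ^ S a * kaw w n.
Proof.
  induction a as [|a IH]; cbn [repeat app].
  - rewrite kaw_y; ring.
  - rewrite kaw_x, IH; cbn [pow]; ring.
Qed.

Lemma dkaw_block a w n : dkaw (repeat lx a ++ ly :: w) (S n) - dkaw (repeat lx a ++ ly :: w) n =
  (/ INR (S n)) ^ S a * dkaw w n - INR (S a) * (/ INR (S n)) ^ S (S a) * kaw w n.
Proof.
  induction a as [|a IH].
  - cbn [repeat app]; rewrite dkaw_y, kaw_y; simpl (INR 1); cbn [pow]; ring.
  - rewrite (S_INR (S a)); cbn [repeat app]; rewrite dkaw_x, IH.
    change (lx :: repeat lx a ++ ly :: w) with (repeat lx (S a) ++ ly :: w).
    rewrite kaw_block; cbn [pow]; ring.
Qed.

(** * Harmonic products of the values and of the derivatives *)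

Definition kawl (n : nat) (ks : list nat) : R := kaw (enc ks 0) n.
Definition dkawl (n : nat) (ks : list nat) : R := dkaw (enc ks 0) n.

Definition kawl_incr (n : nat) (ks : list nat) : R :=
  match ks with
  | [] => 0
  | a :: k => (/ INR (S n)) ^ S a * kawl n k
  end.

(** The eps-coefficient of ([kawl] + eps [dkawl]) / (n + 1 + eps)^(a + 1). *)
Definition dkawl_incr (n : nat) (ks : list nat) : R :=
  match ks with
  | [] => 0
  | a :: k => (/ INR (S n)) ^ S a * dkawl n k - INR (S a) * (/ INR (S n)) ^ S (S a) * kawl n k
  end.

Lemma kawl_S n : kawl (S n) = fun ks => kawl n ks + kawl_incr n ks.
Proof.
  apply functional_extensionality; intros [|a k]; unfold kawl_incr, kawl; cbn [enc].
  - simpl repeat; rewrite !kaw_nil; ring.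
  - rewrite <- kaw_block; ring.
Qed.

Lemma dkawl_S n : dkawl (S n) = fun ks => dkawl n ks + dkawl_incr n ks.
Proof.
  apply functional_extensionality; intros [|a k]; unfold dkawl_incr, dkawl, kawl; cbn [enc].
  - simpl repeat; rewrite !dkaw_nil; ring.
  - rewrite <- dkaw_block; ring.
Qed.

Lemma pre_kawl_incr a n : pre a (kawl_incr n) = fun k => (/ INR (S n)) ^ S a * kawl n k.
Proof. reflexivity. Qed.

Lemma pre_dkawl_incr a n : pre a (dkawl_incr n) = fun k =>
  (/ INR (S n)) ^ S a * dkawl n k - INR (S a) * (/ INR (S n)) ^ S (S a) * kawl n k.
Proof. reflexivity. Qed.

Lemma kawl_nil n : kawl n [] = 1.
Proof. apply kaw_nil. Qed.

Lemma dkawl_nil n : dkawl n [] = 0.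
Proof. apply dkaw_nil. Qed.

Lemma kawl_0_cons a k : kawl 0 (a :: k) = 0.
Proof. unfold kawl; destruct a; apply kaw_cons_0. Qed.

(** Induction on n: the increment of a product of two sums splits as in [harm_cons], the product of
    both increments giving the merged block. *)
Lemma harm_kawl n : forall us vs, harm (kawl n) us vs = kawl n us * kawl n vs.
Proof.
  induction n as [|n IH]; intros [|a u] [|b v];
    try (rewrite ?harm_nil_r; simpl harm; rewrite kawl_nil; ring).
  - rewrite harm_cons, !kawl_0_cons.
    assert (E : forall d, pre d (kawl 0) = fun _ => 0)
      by (intros d; apply functional_extensionality; intros k; apply kawl_0_cons).
    assert (E0 : forall us vs, harm (fun _ => 0) us vs = 0)
      by (intros us vs; exact (linear_zero _ (harm_linear_l us) vs)).
    rewrite !E, !E0; ring.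
  - rewrite kawl_S, harm_plus, IH, harm_cons, !pre_kawl_incr, !harm_scal, !IH.
    unfold kawl_incr; replace (S (S (a + b))) with (S a + S b)%nat by lia.
    rewrite pow_add; ring.
Qed.

Lemma harm_lim (F : nat -> list nat -> R) us vs :
  (forall ks, is_lim_seq (fun n => F n ks) 0) -> is_lim_seq (fun n => harm (F n) us vs) 0.
Proof.
  revert F; pattern us, vs; apply list_pair_ind; clear us vs.
  - intros vs F HF; apply HF.
  - intros a u F HF; apply HF.
  - intros a u b v IH1 IH2 IH3 F HF.
    replace 0 with (0 + 0 + 0) by ring.
    apply is_lim_seq_plus'; [apply is_lim_seq_plus'|].
    + apply (IH1 (fun n => pre a (F n))); intros; apply HF.
    + apply (IH2 (fun n => pre b (F n))); intros; apply HF.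
    + apply (IH3 (fun n => pre (S (a + b)) (F n))); intros; apply HF.
Qed.

(* Both sides have the same increments in n, and their difference tends to 0. *)
Lemma harm_dkawl us vs : forall n, harm (dkawl n) us vs = kawl n us * dkawl n vs + dkawl n us * kawl n vs.
Proof.
  pattern us, vs; apply list_pair_ind; clear us vs.
  - intros vs n; simpl harm; rewrite kawl_nil, dkawl_nil; ring.
  - intros a u n; rewrite harm_nil_r, kawl_nil, dkawl_nil; ring.
  - intros a u b v IH1 IH2 IH3 n.
    (* At n = 0 the equation is the relation sought, so induction on n has no base case; the
       constant value of [q] is found at infinity instead. Its increments vanish by the eps-part of
       the computation in [harm_kawl]. *)
    set (q := fun n => harm (dkawl n) (a :: u) (b :: v)
              - (kawl n (a :: u) * dkawl n (b :: v) + kawl n (b :: v) * dkawl n (a :: u))).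
    assert (Hq : forall n, q n = q 0%nat).
    { clear n; induction n as [|n IHn]; [reflexivity|].
      rewrite <- IHn; unfold q; rewrite dkawl_S, harm_plus, kawl_S.
      rewrite (harm_cons (dkawl_incr n)), !pre_dkawl_incr, !harm_minus, !harm_scal, IH1, IH2, IH3, !harm_kawl.
      unfold kawl_incr, dkawl_incr; replace (S (S (a + b))) with (S a + S b)%nat by lia.
      rewrite plus_INR; cbn [pow]; rewrite pow_add; cbn [pow]; ring. }
    assert (HE : forall ks, is_lim_seq (fun n => dkawl n ks) 0).
    { intros ks; apply (is_lim_seq_ext (fun n => kaw [] n * dkaw (enc ks 0) n)).
      - intros m; rewrite kaw_nil; unfold dkawl; ring.
      - apply kaw_dkaw_lim. }
    assert (Hlim : is_lim_seq q 0).
    { unfold q; replace 0 with (0 - (0 + 0)) by ring.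
      apply is_lim_seq_minus'; [now apply harm_lim|].
      apply is_lim_seq_plus'; apply kaw_dkaw_lim. }
    assert (H0 : q n = 0).
    { apply is_lim_seq_unique in Hlim.
      rewrite (Lim_seq_ext q (fun _ => q n)), Lim_seq_const in Hlim;
        [injection Hlim; auto|intros m; now rewrite (Hq m), (Hq n)]. }
    unfold q in H0; lra.
Qed.

(** * Multiple zeta values *)

(** The part of the nested sum for the word u y with largest summation index m. Every letter gives a
    factor 1/m, and y passes to a smaller index; the empty word stands for the final y. *)
Fixpoint mzv_term (u : word) (m : nat) : R :=
  match m, u with
  | O, _ => 0
  | _, [] => / INR m
  | _, lx :: u' => / INR m * mzv_term u' m
  | _, ly :: u' => / INR m * sumR (mzv_term u') m
  end.

Lemma mzv_term_0 u : mzv_term u 0 = 0.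
Proof. destruct u as [|[] u]; reflexivity. Qed.

Lemma sumR_ext f g M : (forall m, (m < M)%nat -> f m = g m) -> sumR f M = sumR g M.
Proof.
  induction M as [|M IH]; intros H; [reflexivity|].
  cbn [sumR]; rewrite IH, H; [reflexivity|lia|intros; apply H; lia].
Qed.

Lemma sumR_shift f M : sumR f (S M) = f 0%nat + sumR (fun i => f (S i)) M.
Proof.
  induction M as [|M IH]; [simpl; ring|].
  change (sumR f (S (S M))) with (sumR f (S M) + f (S M)); rewrite IH; simpl; ring.
Qed.

(** [k] counts the letters x already read, whose factors 1/m are pending. *)
Lemma zS_idx u : forall k M, zS (idx k (u ++ [ly])) M =
  sumR (fun m => / INR m ^ k * mzv_term u m) M.
Proof.
  induction u as [|[] u IH]; intros k M.
  - simpl app; cbn [idx zS]; apply sumR_ext; intros [|m] _.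
    + rewrite mzv_term_0; ring.
    + cbn [mzv_term pow]; pose proof (INR_S_pos m); field; repeat split; try apply pow_nonzero; lra.
  - cbn [app idx]; rewrite IH; apply sumR_ext; intros [|m] _.
    + rewrite !mzv_term_0; ring.
    + cbn [mzv_term]; pose proof (INR_S_pos m); cbn [pow]; field; repeat split; try apply pow_nonzero; lra.
  - cbn [app idx zS]; apply sumR_ext; intros [|m] _.
    + rewrite mzv_term_0; ring.
    + rewrite IH; cbn [mzv_term].
      rewrite (sumR_ext (fun m0 => / INR m0 ^ 0 * mzv_term u m0) (mzv_term u))
        by (intros; cbn [pow]; rewrite Rinv_1; ring).
      pose proof (INR_S_pos m); cbn [pow]; field; repeat split; try apply pow_nonzero; lra.
Qed.

Lemma mzv_term_bound u : exists C, 0 <= C /\ forall m, 0 <= mzv_term u (S m) <= C * qpow (S m) / INR (S m).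
Proof.
  induction u as [|[] u [C [HC IH]]].
  - exists 1; split; [lra|]; intros m; cbn [mzv_term].
    pose proof (INR_S_pos m) as Hp; pose proof (qpow_ge1 (S m)).
    pose proof (Rinv_0_lt_compat _ Hp); split; [lra|unfold Rdiv; nra].
  - exists C; split; [lra|]; intros m; cbn [mzv_term]; specialize (IH m).
    pose proof (INR_S_pos m) as Hp.
    assert (Hi : 0 < / INR (S m) <= 1).
    { split; [now apply Rinv_0_lt_compat|rewrite <- Rinv_1; apply Rinv_le_contravar; [lra|]].
      rewrite S_INR; pose proof (pos_INR m); lra. }
    split; nra.
  - exists (8 * C); split; [lra|]; intros m; cbn [mzv_term].
    (* With 8 C the increment of the bound is 2 C qpow(m) / (m + 1), which is at least C qpow(m) /
       m. *)
    pose proof (INR_S_pos m) as Hp; pose proof (Rinv_0_lt_compat _ Hp) as Hi.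
    enough (0 <= sumR (mzv_term u) (S m) <= 8 * C * qpow (S m)) by (unfold Rdiv; split; nra).
    clear Hp Hi; induction m as [|m IHm].
    + cbn [sumR]; rewrite mzv_term_0; pose proof (qpow_ge1 1); split; nra.
    + change (sumR (mzv_term u) (S (S m))) with (sumR (mzv_term u) (S m) + mzv_term u (S m)).
      specialize (IH m); pose proof (INR_S_pos m); pose proof (qpow_ge1 (S m)).
      rewrite (qpow_S (S m)).
      assert (C * qpow (S m) / INR (S m) <= 8 * C * (qpow (S m) / (4 * INR (S (S m))))).
      { replace (8 * C * (qpow (S m) / (4 * INR (S (S m)))))
          with (C * qpow (S m) * (2 / INR (S (S m)))) by (field; pose proof (INR_S_pos (S m)); lra).
        apply Rmult_le_compat_l; [nra|].
        rewrite (S_INR (S m)).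
        replace (/ INR (S m)) with (2 / (2 * INR (S m))) by (field; lra).
        apply Rmult_le_compat_l; [lra|]; apply Rinv_le_contravar; [lra|].
        rewrite S_INR; pose proof (pos_INR m); lra. }
      lra.
Qed.

Lemma sumR_sum_n f N : sumR f (S N) = sum_n f N.
Proof.
  induction N as [|N IH]; [rewrite sum_O; simpl; ring|].
  rewrite sum_Sn, <- IH; reflexivity.
Qed.

Lemma series_sumR (f : nat -> R) (l : R) : f 0%nat = 0 ->
  is_series (fun m => f (S m)) l -> is_lim_seq (fun N => sumR f (S N)) l.
Proof.
  intros H0 Hs; apply is_lim_seq_incr_1.
  apply (is_lim_seq_ext (sum_n (fun m => f (S m)))); [|exact Hs].
  intros N; rewrite <- sumR_sum_n, (sumR_shift f (S N)), H0; ring.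
Qed.

Lemma Z_word_lim u :
  is_lim_seq (fun N => sumR (fun m => / INR m * mzv_term u m) (S N)) (Z_word (lx :: u ++ [ly])).
Proof.
  (* Convergence comes first: it is what makes the [epsilon] in [mzv] select the limit. *)
  assert (Hex : exists l, Un_cv (fun N => zS (idx 0 (lx :: u ++ [ly])) (S N)) l).
  { assert (Hs : ex_series (fun m => / INR (S m) * mzv_term u (S m))).
    { destruct (mzv_term_bound u) as [C [HC H]].
      apply (ex_series_Rabs_le _ (fun m => C * (decay (S m) / INR (S m)))).
      - intros m; specialize (H m); pose proof (INR_S_pos m) as Hp.
        pose proof (Rinv_0_lt_compat _ Hp) as Hi; pose proof (qpow_ge1 (S m)).
        rewrite Rabs_pos_eq by nra.
        apply Rle_trans with (/ INR (S m) * (C * qpow (S m) / INR (S m))); [nra|].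
        unfold decay; replace (C * (qpow (S m) ^ 2 / INR (S m) / INR (S m)))
          with (/ INR (S m) * (C * qpow (S m) / INR (S m)) * qpow (S m)) by (field; lra).
        assert (0 <= / INR (S m) * (C * qpow (S m) / INR (S m))) by
          (apply Rmult_le_pos; lra).
        nra.
      - apply (ex_series_scal_l C (fun m => decay (S m) / INR (S m))), decay_summable. }
    destruct Hs as [l Hl]; exists l; apply is_lim_seq_Reals.
    apply (is_lim_seq_ext (fun N => sumR (fun m => / INR m * mzv_term u m) (S N))).
    - intros N; cbn [idx]; rewrite zS_idx; apply sumR_ext; intros m _; now rewrite pow_1.
    - apply series_sumR; [rewrite mzv_term_0; ring|exact Hl]. }
  unfold Z_word; rewrite is_adm_rcons; unfold mzv.
  apply (epsilon_spec (inhabits 0)) in Hex.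
  apply is_lim_seq_Reals in Hex.
  apply (is_lim_seq_ext (fun N => zS (idx 0 (lx :: u ++ [ly])) (S N))); [|exact Hex].
  intros N; cbn [idx]; rewrite zS_idx; apply sumR_ext; intros m _; now rewrite pow_1.
Qed.

Lemma phi_tr_lim (F : nat -> word -> R) (l : word -> R) v :
  (forall u, is_lim_seq (fun N => F N u) (l u)) ->
  is_lim_seq (fun N => phi_tr (F N) v) (phi_tr l v).
Proof.
  revert F l; induction v as [|[] v IH]; intros F l H; cbn [phi_tr]; [apply H| |].
  - apply is_lim_seq_plus'; [apply (IH (fun N => ld lx (F N)))|apply (IH (fun N => ld ly (F N)))];
      intros u; apply H.
  - apply (is_lim_seq_opp _ (phi_tr (ld ly l) v)).
    apply (IH (fun N => ld ly (F N))); intros u; apply H.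
Qed.

Lemma phi_tr_sumR (g : nat -> word -> R) M v :
  phi_tr (fun u => sumR (fun i => g i u) M) v = sumR (fun i => phi_tr (g i) v) M.
Proof.
  induction M as [|M IH]; cbn [sumR]; [apply (linear_zero _ phi_tr_linear)|].
  now rewrite (linear_plus _ phi_tr_linear), IH.
Qed.

(** Under phi a letter x becomes x + y, which turns the strict inner sum into the sum over i <= m of
    [newton], while y only changes sign. *)
Lemma phi_tr_mzv_term v : forall m, phi_tr (fun u => mzv_term u m) v = newton (v ++ [ly]) m.
Proof.
  induction v as [|[] v IH]; intros m.
  - destruct m as [|m]; [reflexivity|]; cbn [phi_tr mzv_term app newton].
    rewrite sumR_shift; replace (sumR _ m) with 0.
    + cbn [newton]; ring.
    + induction m as [|m IH]; [reflexivity|]; cbn [sumR]; rewrite <- IH; cbn [newton]; ring.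
  - destruct m as [|m].
    + transitivity 0; [|reflexivity]; apply phi_tr_eq0; intros; apply mzv_term_0.
    + cbn [phi_tr app]; unfold ld; cbn [mzv_term newton].
      rewrite !(linear_scal _ phi_tr_linear), phi_tr_sumR, IH.
      rewrite (sumR_ext _ (newton (v ++ [ly]))) by (intros; apply IH).
      assert (E0 : newton (v ++ [ly]) 0 = 0) by (destruct v as [|[]]; reflexivity).
      pose proof (sumR_shift (newton (v ++ [ly])) (S m)) as E; rewrite E0 in E.
      change (sumR (newton (v ++ [ly])) (S (S m)))
        with (sumR (newton (v ++ [ly])) (S m) + newton (v ++ [ly]) (S m)) in E.
      rewrite <- (Rplus_0_l (sumR (fun i => newton _ (S i)) _)), <- E; ring.
  - destruct m as [|m].
    + transitivity 0; [|reflexivity]; apply phi_tr_eq0; intros; apply mzv_term_0.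
    + cbn [phi_tr app]; unfold ld; cbn [mzv_term newton].
      rewrite (linear_scal _ phi_tr_linear), phi_tr_sumR.
      rewrite (sumR_ext _ (newton (v ++ [ly]))) by (intros; apply IH); reflexivity.
Qed.

(** The sign is that of phi(y) = -y at the last letter. The rest is [phi_tr_mzv_term], divided by m
    and summed; phi involves finitely many words, so it passes to the limit. *)
Lemma phi_tr_Z_word v : phi_tr (ld lx Z_word) (v ++ [ly]) = - dkaw (v ++ [ly]) 0.
Proof.
  rewrite phi_tr_rcons_y; f_equal.
  pose proof (phi_tr_lim (fun N u => sumR (fun m => / INR m * mzv_term u m) (S N))
    (fun u => Z_word (lx :: u ++ [ly])) v (fun u => Z_word_lim u)) as H1; cbv beta in H1.
  assert (H2 : is_lim_seq (fun N => sumR (fun m => / INR m * newton (v ++ [ly]) m) (S N))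
                 (dkaw (v ++ [ly]) 0)).
  { apply series_sumR.
    - replace (newton (v ++ [ly]) 0) with 0 by (destruct v as [|[]]; reflexivity); ring.
    - apply (is_series_ext (newton_term (v ++ [ly]) 0)); [|apply is_series_dkaw].
      intros m; unfold newton_term; simpl newton_diff; apply Rmult_comm. }
  apply is_lim_seq_unique in H1; apply is_lim_seq_unique in H2.
  rewrite (Lim_seq_ext _ (fun N => sumR (fun m => / INR m * newton (v ++ [ly]) m) (S N))) in H1.
  - rewrite H2 in H1; injection H1; auto.
  - intros N; rewrite phi_tr_sumR; apply sumR_ext; intros m _.
    now rewrite (linear_scal _ phi_tr_linear), phi_tr_mzv_term.
Qed.

(* The linear part of Kawashima's relation. *)
Lemma harm_Z_word us vs : us <> [] -> vs <> [] -> harm (fenc (phi_tr (ld lx Z_word)) 0) us vs = 0.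
Proof.
  intros Hu Hv; destruct us as [|a u]; [congruence|]; destruct vs as [|b v]; [congruence|].
  (* [phi_tr_Z_word] concerns nonempty lists, and no others occur in the product. *)
  assert (E : forall d, pre d (fenc (phi_tr (ld lx Z_word)) 0) = pre d (fun k => (-1) * dkawl 0 k)).
  { intros d; apply functional_extensionality; intros k; unfold pre, fenc, dkawl.
    destruct (enc_rcons d k) as [w ->]; rewrite phi_tr_Z_word; ring. }
  rewrite harm_cons, !E, <- harm_cons, harm_scal, harm_dkawl, !kawl_0_cons; ring.
Qed.

Theorem mainTheorem1 : forall (n : nat) (c : Q), (1 <= n)%nat ->
  forall p : hpoly, inH0 p -> inH0 (partial n c p) /\ Zmap (partial n c p) = 0%R.
Proof.
  intros n c _ p Hp.
  (* Both claims are instances: [f] is the coefficient functional of a non-admissible word, or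
     [Z_word]. On each word either the transposed functional vanishes or [p] has coefficient 0. *)
  assert (main : forall f,
    (forall us vs, us <> [] -> vs <> [] -> harm (fenc (phi_tr (ld lx f)) 0) us vs = 0) ->
    ev f (partial n c p) = 0).
  { intros f Hf; unfold partial; rewrite ev_pscale, ev_iter_comm, ev_eq0; [ring|].
    intros u; destruct (list_eq_dec letter_eq_dec u []) as [->|Hu].
    - left; now apply partial_tr_adm_eq0; auto.
    - destruct (is_adm u) eqn:Ha.
      + left; now apply partial_tr_adm_eq0; auto.
      + right; rewrite <- coeff_ev, (Qeq_eqR _ _ (Hp u Hu Ha)); unfold Q2R; simpl; lra. }
  split.
  - intros u Hu Ha; apply eqR_Qeq.
    rewrite coeff_ev, main; [unfold Q2R; simpl; lra|].
    intros us vs Hus _; now apply harm_nonadm.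
  - exact (main Z_word harm_Z_word).
Qed.
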